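(* Let $Y$ be the limiting Quicksort random variable and $\phi(t)=\mathbf{E}e^{itY}$ its characteristic function. For every real $p\ge 0$ the quantity $c_p:=\sup_{t\in\mathbb{R}}|t|^p|\phi(t)|$ satisfies $0<c_p<\infty$; thus $c_p$ is the smallest constant such that $|\phi(t)|\le c_p|t|^{-p}$ for all $t\in\mathbb{R}$. Moreover, $c_0=1$, $c_{1/2}\le 2$, $c_{3/4}\le\sqrt{8\pi}$, $c_1\le 4\pi$, $c_{3/2}<187$, $c_{5/2}<103215$, $c_{7/2}<197102280$, and $$c_{p_1}^{1/p_1}\le c_{p_2}^{1/p_2}\quad (0<p_1\le p_2),\qquad c_{p+1}\le 2^{p+1}c_p^{1+1/p}\,\frac{p}{p-1}\quad (p>1),\qquad c_p\le 2^{p^2+6p}\quad (p>0).$$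
   Context: Let $g(u):=2u\ln u+2(1-u)\ln(1-u)+1$ for $u\in(0,1)$. The limiting Quicksort random variable $Y$ is the limit in distribution of $(X_n-\mathbf{E}X_n)/n$, where $X_n$ is the number of comparisons used by randomized Quicksort on $n$ distinct numbers; equivalently, its law is the unique law with $\mathbf{E}Y=0$ and finite variance satisfying $Y\overset{d}{=}UY+(1-U)Z+g(U)$, where on the right $U,Y,Z$ are independent, $Z\overset{d}{=}Y$ and $U$ is uniform on $(0,1)$. $Y$ has finite moment generating function everywhere. *)

(* Defs.v *)
From HB Require Import structures.
From mathcomp Require Import all_boot all_order all_algebra.
From mathcomp Require Import all_classical all_reals all_analysis.
Set Implicit Arguments. Unset Strict Implicit. Unset Printing Implicit Defensive.
Import Order.TTheory GRing.Theory Num.Theory.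
Import numFieldNormedType.Exports.
Local Open Scope classical_set_scope.
Local Open Scope ring_scope.

Definition qs_g (R : realType) (u : R) : R :=
  2 * u * ln u + 2 * (1 - u) * ln (1 - u) + 1.

(* The law mu on R satisfies the Quicksort distributional fixed-point equation
   Y =d U Y + (1-U) Z + g(U), with U uniform on (0,1), Y, Z ~ mu, U,Y,Z
   independent: for every Borel A, mu A equals the probability of the event
   {U Y + (1-U) Z + g(U) in A} under the product law
   (Lebesgue on (0,1)) x (mu x mu). *)
Definition qs_fixed_point (R : realType) (mu : probability R R) : Prop :=
  forall A : set R, measurable A ->
    mu A = ((@lebesgue_measure R) \x (mu \x mu))%E
             [set w : R * (R * R) | 0 < w.1 < 1 /\
                A (w.1 * w.2.1 + (1 - w.1) * w.2.2 + qs_g w.1)].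

Definition quicksort_law (R : realType) (mu : probability R R) : Prop :=
  [/\ mu.-integrable setT (fun x : R => (x ^+ 2)%:E),
      (\int[mu]_x (x%:E) = 0)%E
    & qs_fixed_point mu].

Definition charfun_re (R : realType) (mu : probability R R) (t : R) : R :=
  Rintegral mu setT (fun x => cos (t * x)).
Definition charfun_im (R : realType) (mu : probability R R) (t : R) : R :=
  Rintegral mu setT (fun x => sin (t * x)).
Definition charfun_abs (R : realType) (mu : probability R R) (t : R) : R :=
  Num.sqrt (charfun_re mu t ^+ 2 + charfun_im mu t ^+ 2).

Definition cp (R : realType) (mu : probability R R) (p : R) : \bar R :=
  ereal_sup [set ((`|t| `^ p) * charfun_abs mu t)%:E | t in [set: R]].

(* Main.v *)
(* For a unit vector (p, q) let F x = p cos (t x) + q sin (t x).  The modulus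
   |phi t| is the maximum over (p, q) of the mean of F, so it suffices to bound
   the mean of the nonnegative function 1 + F, to which the fixed-point equation
   and Tonelli's theorem apply.  The phase h u = u y + (1 - u) z + g u satisfies
   h'' >= 8; integrating over u first, van der Corput's argument around the zero
   of h' gives |phi t| <= 2 t^(-1/2).  Integrating over (y, z) first gives
   |phi t| <= int_0^1 |phi (u t)| |phi ((1 - u) t)| du, which improves known
   decay: two factors of order 1/2 give 4 pi / t by the arcsine integral; the
   orders 1/2 and 1, for the smaller and the larger of u t and (1 - u) t, give
   32 pi t^(-3/2); and min 1 (c (u t)^-p) for the smaller argument with
   c (t / 2)^-p for the larger one gives the recursion from p to p + 1.
   Starting from 32 pi <= 2^7, which is below 187, the recursion yields
   c_{5/2} <= 2^16 and c_{7/2} <= 2^26.9, and by induction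
   c_p <= 2^(p^2 + 6 p - 2) for p >= 5/2. *)
Require Import Defs.
From HB Require Import structures.
From mathcomp Require Import all_boot all_order all_algebra.
From mathcomp Require Import all_classical all_reals all_analysis.
From mathcomp Require Import ring lra.
From mathcomp Require Import measurable_realfun.
Import Order.TTheory GRing.Theory Num.Theory.
Import numFieldNormedType.Exports.
Local Open Scope classical_set_scope.
Local Open Scope ring_scope.

Set Implicit Arguments.
Unset Strict Implicit.
Unset Printing Implicit Defensive.

(** * van der Corput estimate *)

(** Monotone convergence along compact subintervals, with the fundamental theorem of calculus on
    each of them. Only bounds on [G] inside the interval enter, so [g] may blow up at the endpoints,
    as the power and arcsine integrands below do. *)
Lemma ge0_integral_oo_le_antiderivative (R : realType) (f g G : R -> R)
    (a b A B : R) : a < b ->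
  (forall x, a < x < b -> is_derive x 1 G (g x)) ->
  (forall x, a < x < b -> {for x, continuous g}) ->
  (forall x, a < x < b -> 0 <= f x <= g x) ->
  (forall x, a < x < b -> A <= G x <= B) ->
  measurable_fun `]a, b[ f ->
  (\int[@lebesgue_measure R]_(x in `]a, b[) (f x)%:E <= (B - A)%:E)%E.
Proof.
move=> ab dG cg fg GAB mf.
have mg : measurable_fun `]a, b[ g.
  apply: open_continuous_measurable_fun; first exact: interval_open.
  by move=> x; rewrite inE/= in_itv/=; exact: cg.
(* The shift by 3 gives [2 * e n < b - a] already at [n = 0], so every [F n] is a nondegenerate
   interval. *)
pose e n := (b - a) / (n.+3)%:R.
have e_gt0 n : 0 < e n by rewrite divr_gt0// subr_gt0.
have e_small n : e n + e n < b - a.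
  rewrite -mulr2n -mulr_natr -mulrA gtr_pMr ?subr_gt0//.
  by rewrite mulrC ltr_pdivrMr// mul1r ltr_nat.
have e_le m n : (m <= n)%N -> e n <= e m.
  by move=> mn; rewrite ler_pM2l ?subr_gt0// lef_pV2 ?posrE// ler_nat !ltnS.
pose F n : set R := `[a + e n, b - e n]%classic.
have FI n x : F n x -> a < x < b.
  rewrite /F/= in_itv/= => /andP[h1 h2]; have := e_gt0 n.
  by move=> ?; apply/andP; split; lra.
have FE : `]a, b[%classic = \bigcup_n F n.
  apply/seteqP; split => [x|x [n _ /FI]]; last by rewrite /= in_itv.
  rewrite /= in_itv/= => /andP[ax xb].
  pose d := Num.min (x - a) (b - x).
  have d_gt0 : 0 < d by rewrite lt_min !subr_gt0 ax xb.
  pose n := Num.truncn ((b - a) / d).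
  have en : e n <= d.
    rewrite ler_pdivrMr// -ler_pdivrMl// mulrC.
    apply/ltW; apply: lt_le_trans (truncnS_gt _) _.
    by rewrite ler_nat; apply/ltnW/ltnW.
  exists n => //; rewrite /F/= in_itv/=.
  move: en; rewrite le_min => /andP[? ?]; apply/andP; split; lra.
have F_sub n : F n `<=` `]a, b[%classic by rewrite FE; exact: bigcup_sup.
have mF n : measurable (F n) by exact: measurable_itv.
have le1 : (\int[@lebesgue_measure R]_(x in `]a, b[) (f x)%:E <=
            \int[@lebesgue_measure R]_(x in `]a, b[) (g x)%:E)%E.
  apply: ge0_le_integral => //=.
  - by move=> x; rewrite in_itv/= => /fg/andP[f0 _]; rewrite lee_fin.
  - exact/measurable_EFinP.
  - exact/measurable_EFinP.
  - by move=> x; rewrite in_itv/= => /fg/andP[_ ?]; rewrite lee_fin.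
apply: le_trans le1 _; rewrite FE.
have cvgF : (\int[@lebesgue_measure R]_(x in F i) (g x)%:E @[i --> \oo] -->
    \int[@lebesgue_measure R]_(x in \bigcup_i F i) (g x)%:E)%E.
  apply: ge0_nondecreasing_set_cvg_integral => //.
  - move=> m n mn; apply/subsetPset => x; rewrite /F/= !in_itv/= => /andP[? ?].
    by have := e_le _ _ mn; move=> ?; apply/andP; split; lra.
  - by move=> i; apply/measurable_EFinP; exact: measurable_funS mg.
  - move=> i x /FI/fg/andP[f0 fgx]; rewrite lee_fin; exact: le_trans fgx.
rewrite -(cvg_lim _ cvgF)//; apply: lime_le; first by apply/cvg_ex; eexists; exact: cvgF.
apply: nearW => n.
have abn : a + e n < b - e n by have := e_small n; lra.
rewrite /F (@continuous_FTC2 R g G)//.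
- rewrite -EFinB lee_fin.
  have [h1 h2] : a < a + e n < b /\ a < b - e n < b.
    by have := e_gt0 n; have := e_small n; split; apply/andP; split; lra.
  have /andP[? ?] := GAB _ h1; have /andP[? ?] := GAB _ h2; lra.
- apply: continuous_in_subspaceT => x.
  by rewrite inE => /FI; exact: cg.
- have cG x : a < x < b -> {for x, continuous G}.
    move=> /dG dGx; apply: differentiable_continuous.
    by apply/derivable1_diffP; exact: ex_derive.
  split.
  + move=> x; rewrite in_itv/= => /andP[h1 h2].
    apply: ex_derive; apply: dG; have := e_gt0 n => ?; apply/andP; split; lra.
  + apply: cvg_at_right_filter; apply: cG.
    by have := e_gt0 n; have := e_small n; move=> ? ?; apply/andP; split; lra.
  + apply: cvg_at_left_filter; apply: cG.
    by have := e_gt0 n; have := e_small n; move=> ? ?; apply/andP; split; lra.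
- move=> x; rewrite in_itv/= => /andP[h1 h2]; rewrite derive1E.
  apply: derive_val; apply: dG; have := e_gt0 n => ?; apply/andP; split; lra.
Qed.

Lemma is_derive1_continuous (R : realType) (f : R -> R) (x df : R) :
  is_derive x 1 f df -> {for x, continuous f}.
Proof.
by move=> dfx; apply: differentiable_continuous; apply/derivable1_diffP; exact: ex_derive.
Qed.

(** Cauchy-Schwarz in the plane, read off from Lagrange's identity. *)
Lemma trig_bound (R : realType) (p q x : R) : p ^+ 2 + q ^+ 2 = 1 ->
  -1 <= p * cos x + q * sin x <= 1.
Proof.
move=> pq1; have cs := cos2Dsin2 x.
have : (p * cos x + q * sin x) ^+ 2 <= 1 ^+ 2.
  rewrite expr1n.
  have -> : (p * cos x + q * sin x) ^+ 2 =
      (p ^+ 2 + q ^+ 2) * (cos x ^+ 2 + sin x ^+ 2) - (p * sin x - q * cos x) ^+ 2.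
    by ring.
  by rewrite pq1 cs mul1r lerBlDr lerDl sqr_ge0.
by move=> h; apply/andP; split; nra.
Qed.

(* The primitive [G = (p sin h - q cos h - 1) / h' + x] has derivative at least
   the integrand, because [G' - integrand = (1 - p sin h + q cos h) h'' / h'^2];
   the summand [x] and the constant [1] keep everything nonnegative. *)
Lemma van_der_corput_piece (R : realType) (p q : R) (h h1 h2 : R -> R)
    (a b c : R) : p ^+ 2 + q ^+ 2 = 1 -> a < b -> 0 < c ->
  (forall x, a < x < b -> is_derive x 1 h (h1 x)) ->
  (forall x, a < x < b -> is_derive x 1 h1 (h2 x)) ->
  (forall x, a < x < b -> {for x, continuous h2}) ->
  (forall x, a < x < b -> 0 <= h2 x) ->
  (forall x, a < x < b -> c <= h1 x) \/ (forall x, a < x < b -> h1 x <= - c) ->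
  measurable_fun `]a, b[ h ->
  (\int[@lebesgue_measure R]_(x in `]a, b[)
     (1 + (p * cos (h x) + q * sin (h x)))%:E <= (b - a + 2 / c)%:E)%E.
Proof.
move=> pq1 ab c_gt0 dh dh1 ch2 h2_ge0 h1c mh.
pose S x := p * sin (h x) - q * cos (h x) - 1.
have S_bnd x : -2 <= S x <= 0.
  have := @trig_bound R (- q) p (h x).
  rewrite sqrrN addrC => /(_ pq1) /andP[? ?]; rewrite /S.
  apply/andP; split; lra.
have h1_neq0 x : a < x < b -> h1 x != 0.
  move=> xab; case: h1c => /(_ _ xab) ?; first by rewrite gt_eqF//; lra.
  by rewrite lt_eqF//; lra.
pose G x := S x * (h1 x)^-1 + x.
pose g x := 1 + (p * cos (h x) + q * sin (h x)) - S x * h2 x / h1 x ^+ 2.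
(* Since [-2 <= S <= 0], the quotient [S / h1] lies in [[-2/c, 0]] when [h1 >= c] and in [[0, 2/c]]
   when [h1 <= -c]. In both cases the range of [G] has length at most [b - a + 2/c]. *)
have [A [B [BA HG]]] : exists A B, B - A = b - a + 2 / c /\
    forall x, a < x < b -> A <= G x <= B.
  have c2 : 0 <= 2 / c by rewrite divr_ge0// ltW.
  case: h1c => h1c.
    exists (a - 2 / c), b; split; first by ring.
    move=> x xab; have h1x := h1c _ xab; rewrite /G.
    have ? : 0 < h1 x by lra.
    have /andP[? ?] := S_bnd x; have /andP[? ?] := xab.
    have ? : S x * (h1 x)^-1 <= 0 by rewrite mulr_le0_ge0// invr_ge0 ltW.
    have ? : - (2 / c) <= S x * (h1 x)^-1.
      rewrite ler_pdivlMr//; apply: (@le_trans _ _ (-2)); last lra.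
      rewrite mulNr lerN2 -mulrA ler_peMr// ler_pdivlMl// mulr1; lra.
    apply/andP; split; lra.
  exists a, (b + 2 / c); split; first by ring.
  move=> x xab; have h1x := h1c _ xab; rewrite /G.
  have ? : 0 < - h1 x by lra.
  have /andP[? ?] := S_bnd x; have /andP[? ?] := xab.
  have -> : S x * (h1 x)^-1 = (- S x) * (- h1 x)^-1 by rewrite invrN mulrNN.
  have ? : 0 <= - S x * (- h1 x)^-1.
    by apply: mulr_ge0; [lra|rewrite invr_ge0; lra].
  have ? : - S x * (- h1 x)^-1 <= 2 / c.
    rewrite ler_pdivrMr//; apply: (@le_trans _ _ 2); first lra.
    rewrite -mulrA ler_peMr// ler_pdivlMl// mulr1; lra.
  apply/andP; split; lra.
rewrite -BA; apply: (@ge0_integral_oo_le_antiderivative R _ g G) => //.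
- move=> x xab.
  have dS : is_derive x 1 S (h1 x * (p * cos (h x) + q * sin (h x))).
    have dhx := dh _ xab.
    have ds := @is_derive1_comp R sin h x _ _ (is_derive_sin (h x)) dhx.
    have dc := @is_derive1_comp R cos h x _ _ (is_derive_cos (h x)) dhx.
    have := is_deriveB (is_deriveB (is_deriveZ p ds) (is_deriveZ q dc))
              (is_derive_cst (1 : R) x 1).
    move/is_derive_eq; apply; rewrite /GRing.scale/=; ring.
  have dV := @is_deriveV R h1 x _ _ (h1_neq0 _ xab) (dh1 _ xab).
  have := is_deriveD (is_deriveM dS dV) (is_derive_id x (1 : R)).
  move/is_derive_eq; apply; rewrite /g /GRing.scale/=.
  by have := h1_neq0 _ xab => ?; field.
- move=> x xab.
  have chx := @is_derive1_continuous R _ _ _ (dh x xab).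
  have ch1x := @is_derive1_continuous R _ _ _ (dh1 _ xab).
  have csx : sin (h y) @[y --> x] --> sin (h x).
    by apply: (@continuous_comp _ _ _ h sin) => //; exact: continuous_sin.
  have ccx : cos (h y) @[y --> x] --> cos (h x).
    by apply: (@continuous_comp _ _ _ h cos) => //; exact: continuous_cos.
  apply: cvgB.
    by apply: cvgD; [exact: cvg_cst|apply: cvgD; apply: cvgM => //; exact: cvg_cst].
  apply: cvgM; last first.
    apply: cvgV; first by rewrite expf_neq0// h1_neq0.
    by rewrite expr2; under eq_fun do rewrite expr2; exact: cvgM.
  apply: cvgM; last exact: ch2.
  apply: cvgB; last exact: cvg_cst.
  by apply: cvgB; apply: cvgM => //; exact: cvg_cst.
- move=> x xab; have /andP[? ?] := @trig_bound R _ _ (h x) pq1.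
  have ? : S x * h2 x / h1 x ^+ 2 <= 0.
    rewrite -mulrA mulr_le0_ge0 ?divr_ge0 ?sqr_ge0 ?h2_ge0//.
    by have /andP[] := S_bnd x.
  by rewrite /g; apply/andP; split; lra.
- apply: measurable_funD => //; apply: measurable_funD.
  + apply: measurable_funM => //.
    by apply: measurableT_comp => //; apply: continuous_measurable_fun; exact: continuous_cos.
  + apply: measurable_funM => //.
    by apply: measurableT_comp => //; apply: continuous_measurable_fun; exact: continuous_sin.
Qed.

(** * The Quicksort phase and its oscillatory integral *)

Lemma is_derive1_onem (R : realType) (x : R) :
  is_derive x 1 (fun u : R => 1 - u) (- 1).
Proof.
have := is_deriveB (is_derive_cst (1 : R) x 1) (is_derive_id x (1 : R)).
by move/is_derive_eq; apply; rewrite sub0r.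
Qed.

Lemma is_derive1_ln_onem (R : realType) (x : R) : x < 1 ->
  is_derive x 1 (fun u : R => ln (1 - u)) (- (1 - x)^-1).
Proof.
move=> x1; have x1' : 0 < 1 - x by rewrite subr_gt0.
have := @is_derive1_comp R (@ln R) _ x _ _ (is_derive1_ln x1') (is_derive1_onem x).
by move/is_derive_eq; apply; rewrite mulrN1.
Qed.

Lemma measurable_onem (R : realType) : measurable_fun [set: R] (fun u : R => 1 - u).
Proof. by apply: measurable_funB. Qed.

Lemma measurable_qs_g (R : realType) : measurable_fun [set: R] (@qs_g R).
Proof.
apply: measurable_funD => //; apply: measurable_funD.
- apply: measurable_funM; last exact: measurable_ln.
  exact: measurable_funM.
- apply: measurable_funM.
    by apply: measurable_funM => //; exact: measurable_onem.
  by apply: measurableT_comp; [exact: measurable_ln|exact: measurable_onem].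
Qed.

(** Half the derivative of [qs_g] on the unit interval. *)
Definition logit (R : realType) (x : R) : R := ln x - ln (1 - x).

Lemma is_derive_logit (R : realType) (x : R) : 0 < x < 1 ->
  is_derive x 1 (@logit R) (x^-1 + (1 - x)^-1).
Proof.
move=> /andP[x0 x1].
have := is_deriveB (is_derive1_ln x0) (is_derive1_ln_onem x1).
by move/is_derive_eq; apply; rewrite opprK.
Qed.

(** The inverse is the logistic function. This provides the zero of the phase derivative. *)
Lemma logit_surj (R : realType) (d : R) : exists2 x, 0 < x < 1 & logit x = d.
Proof.
have e0 := expR_gt0 d; have e1 : 0 < 1 + expR d by lra.
have e2 : 1 + expR d != 0 by rewrite gt_eqF.
exists (expR d / (1 + expR d)).
  by rewrite divr_gt0//= ltr_pdivrMr// mul1r; lra.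
rewrite /logit.
have -> : 1 - expR d / (1 + expR d) = (1 + expR d)^-1 by field.
rewrite ln_div ?posrE// lnV ?posrE// expRK; lra.
Qed.

(** Mean value theorem: the derivative is [1 / (c (1 - c))], and [c (1 - c) <= 1/4]. *)
Lemma logit_increment (R : realType) (x y : R) : 0 < x -> y < 1 -> x <= y ->
  4 * (y - x) <= logit y - logit x.
Proof.
move=> x0 y1; rewrite le_eqVlt => /predU1P[->|xy]; first by rewrite !subrr mulr0.
have dL z : x <= z <= y -> is_derive z 1 (@logit R) (z^-1 + (1 - z)^-1).
  by move=> /andP[? ?]; apply: is_derive_logit; apply/andP; split; lra.
have [||c cxy ->] := @MVT R (@logit R) (fun z => z^-1 + (1 - z)^-1) x y xy.
- move=> z; rewrite in_itv/= => /andP[? ?]; apply: dL.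
  by apply/andP; split; lra.
- apply: derivable_within_continuous => z; rewrite in_itv/= => zxy.
  by apply: ex_derive; exact: dL.
move: cxy; rewrite in_itv/= => /andP[xc cy].
rewrite ler_pM2r ?subr_gt0//.
have c0 : 0 < c by lra. have c1 : 0 < 1 - c by lra.
have -> : c^-1 + (1 - c)^-1 = (c * (1 - c))^-1.
  by field; apply/andP; split; rewrite gt_eqF.
rewrite -[4]invrK lef_pV2 ?posrE ?mulr_gt0//.
by have := sqr_ge0 (c - 2^-1); rewrite expr2 => ?; nra.
Qed.

(** Let [a] be the zero of [h1]. Then [h1] has modulus at least [8 t |u - a|], so
    [van_der_corput_piece] applies at distance at least [d] from [a], and the trivial bound 2 on the
    integrand serves in between. *)
Lemma qs_oscillatory_integral (R : realType) (p q t y z : R) :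
  p ^+ 2 + q ^+ 2 = 1 -> 0 < t ->
  (\int[@lebesgue_measure R]_(u in `]0%R, 1%R[)
    (1 + (p * cos (t * (u * y + (1 - u) * z + qs_g u)) +
          q * sin (t * (u * y + (1 - u) * z + qs_g u))))%:E <=
   (1 + 2 / Num.sqrt t)%:E)%E.
Proof.
move=> pq1 t0.
pose h u := t * (u * y + (1 - u) * z + qs_g u).
pose h1 u := t * (y - z + 2 * logit u).
pose h2 u := t * (2 * (u^-1 + (1 - u)^-1)).
have dh (u : R) : 0 < u < 1 -> is_derive u 1 h (h1 u).
  move=> /andP[u0 u1].
  have di := is_derive_id u (1 : R).
  have d1 := is_deriveM di (is_derive_cst y u 1).
  have d2 := is_deriveM (is_derive1_onem u) (is_derive_cst z u 1).
  have d3 := is_deriveM (is_deriveZ 2 di) (is_derive1_ln u0).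
  have d4 := is_deriveM (is_deriveZ 2 (is_derive1_onem u)) (is_derive1_ln_onem u1).
  have := is_deriveZ t (is_deriveD (is_deriveD d1 d2)
    (is_deriveD (is_deriveD d3 d4) (is_derive_cst (1 : R) u 1))).
  move/is_derive_eq; apply; rewrite /h1 /logit /GRing.scale/= /cst.
  rewrite -[2 *: u]/(2 * u) -[2 *: (1 - u)]/(2 * (1 - u)).
  by field; rewrite !gt_eqF ?subr_gt0.
have dh1 (u : R) : 0 < u < 1 -> is_derive u 1 h1 (h2 u).
  move=> u01.
  have := is_deriveZ t (is_deriveD (is_derive_cst (y - z) u 1)
    (is_deriveZ 2 (is_derive_logit u01))).
  by move/is_derive_eq; apply; rewrite /h2 /GRing.scale/=; ring.
have ch2 (u : R) : 0 < u < 1 -> {for u, continuous h2}.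
  move=> /andP[u0 u1]; apply: cvgM; first exact: cvg_cst.
  apply: cvgM; first exact: cvg_cst.
  apply: cvgD; apply: cvgV; rewrite ?gt_eqF ?subr_gt0//.
  by apply: cvgB => //; exact: cvg_cst.
have h2_ge0 (u : R) : 0 < u < 1 -> 0 <= h2 u.
  move=> /andP[u0 u1]; rewrite !mulr_ge0 ?addr_ge0 ?invr_ge0 ?subr_ge0//; exact: ltW.
have mh : measurable_fun [set: R] h.
  apply: measurable_funM => //; apply: measurable_funD; last exact: measurable_qs_g.
  apply: measurable_funD; apply: measurable_funM => //; exact: measurable_onem.
pose f u := 1 + (p * cos (h u) + q * sin (h u)).
have f_ge0 u : 0 <= f u.
  by have /andP[? ?] := @trig_bound R p q (h u) pq1; rewrite /f; lra.
have f_le2 u : f u <= 2.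
  by have /andP[? ?] := @trig_bound R p q (h u) pq1; rewrite /f; lra.
have mf : measurable_fun [set: R] (EFin \o f).
  apply/measurable_EFinP; apply: measurable_funD => //; apply: measurable_funD.
  + apply: measurable_funM => //.
    by apply: measurableT_comp => //; apply: continuous_measurable_fun; exact: continuous_cos.
  + apply: measurable_funM => //.
    by apply: measurableT_comp => //; apply: continuous_measurable_fun; exact: continuous_sin.
rewrite [leLHS](_ : _ = \int[@lebesgue_measure R]_(u in `]0%R, 1%R[) (f u)%:E)%E//.
have [a /andP[a0 a1] La] := @logit_surj R ((z - y) / 2).
have h1E u : h1 u = 2 * t * (logit u - logit a) by rewrite /h1 La; field.
pose s := Num.sqrt t.
have s0 : 0 < s by rewrite sqrtr_gt0.
have tE : t = s ^+ 2 by rewrite sqr_sqrtr// ltW.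
(* The excess over 1 is at most [2 d] from the middle and [2 / (8 t d)] from each side; this [d]
   minimizes the sum. It makes the lower bound [8 t d] on the derivative equal to [4 s]. *)
pose d := (2 * s)^-1.
have d0 : 0 < d by rewrite invr_gt0 mulr_gt0.
have sd : s * d = 2^-1 by rewrite /d; field; rewrite gt_eqF.
(* The zero may lie close to 0 or 1, so the middle interval is clipped; a side piece is then empty
   and is treated apart. *)
pose a1' := Num.max 0 (a - d); pose b1 := Num.min 1 (a + d).
have a1'0 : 0 <= a1' by rewrite le_max lexx.
have a1'a : a1' < a by rewrite gt_max a0/=; lra.
have b1a : a < b1 by rewrite lt_min a1/=; lra.
have b11 : b1 <= 1 by rewrite ge_min lexx.
have lb1 : a - d <= a1' by rewrite le_max lexx orbT.
have ub1 : b1 <= a + d by rewrite ge_min lexx orbT.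
have c0 : 0 < 4 * s by rewrite mulr_gt0.
have e0 : 2 / (4 * s) = d by rewrite /d; field; rewrite gt_eqF.
have I1 : (\int[@lebesgue_measure R]_(u in `]0%R, a1'[) (f u)%:E <= (a1' + d)%:E)%E.
  move: a1'0; rewrite le_eqVlt => /predU1P[<-|a1'0].
    by rewrite set_itvoo0 integral_set0 lee_fin; lra.
  have -> : a1' + d = a1' - 0 + 2 / (4 * s) by rewrite e0 subr0.
  refine (@van_der_corput_piece R p q h h1 h2 0 a1' (4 * s) pq1 a1'0 c0 _ _ _ _ _ _).
  - by move=> x /andP[? ?]; apply: dh; apply/andP; split; lra.
  - by move=> x /andP[? ?]; apply: dh1; apply/andP; split; lra.
  - by move=> x /andP[? ?]; apply: ch2; apply/andP; split; lra.
  - by move=> x /andP[? ?]; apply: h2_ge0; apply/andP; split; lra.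
  - right=> x /andP[x0 xa]; rewrite h1E.
    have xa' : x < a - d by move: xa; rewrite /a1' lt_max => /orP[] //; lra.
    have ? := @logit_increment R x a x0 a1 (ltW (lt_trans xa a1'a)).
    have : 2 * t * (4 * d) <= 2 * t * (logit a - logit x).
      by rewrite ler_pM2l ?mulr_gt0//; lra.
    have -> : 2 * t * (4 * d) = 8 * s * (s * d) by rewrite tE; ring.
    by rewrite sd; lra.
  - exact: measurable_funTS.
have I3 : (\int[@lebesgue_measure R]_(u in `]b1, 1%R[) (f u)%:E <= (1 - b1 + d)%:E)%E.
  move: b11; rewrite le_eqVlt => /predU1P[->|b11].
    by rewrite set_itvoo0 integral_set0 lee_fin; lra.
  have -> : 1 - b1 + d = 1 - b1 + 2 / (4 * s) by rewrite e0.
  refine (@van_der_corput_piece R p q h h1 h2 b1 1 (4 * s) pq1 b11 c0 _ _ _ _ _ _).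
  - by move=> x /andP[? ?]; apply: dh; apply/andP; split; lra.
  - by move=> x /andP[? ?]; apply: dh1; apply/andP; split; lra.
  - by move=> x /andP[? ?]; apply: ch2; apply/andP; split; lra.
  - by move=> x /andP[? ?]; apply: h2_ge0; apply/andP; split; lra.
  - left=> x /andP[xb x1]; rewrite h1E.
    have xa' : a + d < x by move: xb; rewrite /b1 gt_min => /orP[] //; lra.
    have ? := @logit_increment R a x a0 x1 (ltW (lt_trans b1a xb)).
    have : 2 * t * (4 * d) <= 2 * t * (logit x - logit a).
      by rewrite ler_pM2l ?mulr_gt0//; lra.
    have -> : 2 * t * (4 * d) = 8 * s * (s * d) by rewrite tE; ring.
    by rewrite sd; lra.
  - exact: measurable_funTS.
have I2 : (\int[@lebesgue_measure R]_(u in `[a1', b1]) (f u)%:E <= (2 * (b1 - a1'))%:E)%E.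
  apply: (@le_trans _ _ (\int[@lebesgue_measure R]_(u in `[a1', b1]) (cst 2%:E u))%E).
    apply: ge0_le_integral => //.
    - by move=> x _; rewrite lee_fin.
    - exact: measurable_funTS.
    - by move=> x _; rewrite lee_fin.
  by rewrite integral_cst//= lebesgue_measure_itv/= lte_fin (lt_trans a1'a b1a) -EFinB -EFinM.
apply: (@le_trans _ _ (\int[@lebesgue_measure R]_(u in
    (`]0%R, a1'[ `|` `[a1', b1]) `|` `]b1, 1%R[) (f u)%:E)%E).
  apply: ge0_subset_integral => //.
  - by apply: measurableU => //; exact: measurableU.
  - exact: measurable_funTS.
  - by move=> x _; rewrite lee_fin.
  - move=> x /=; rewrite !in_itv/= => /andP[x0 x1].
    have [?|?] := ltP x a1'; first by left; left; rewrite x0.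
    by have [?|?] := leP x b1; [left; right|right; rewrite x1].
rewrite ge0_integral_setU//; last 4 first.
- exact: measurableU.
- exact: measurable_funTS.
- by move=> x _; rewrite lee_fin.
- apply/disj_setPS => x /=; rewrite !in_itv/= => -[[/andP[? ?]|/andP[? ?]] /andP[? ?]]; lra.
rewrite ge0_integral_setU//; last 3 first.
- exact: measurable_funTS.
- by move=> x _; rewrite lee_fin.
- by apply/disj_setPS => x /=; rewrite !in_itv/= => -[/andP[? ?] /andP[? ?]]; lra.
(* The three bounds add up to [1 + (b1 - a1') + 2 d], and [b1 - a1' <= 2 d]. *)
apply: le_trans (leeD (leeD I1 I2) I3) _.
rewrite -!EFinD lee_fin -/s.
have -> : 2 / s = 4 * d by rewrite /d; field; rewrite gt_eqF.
lra.
Qed.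

(** * Integrals under the fixed-point equation *)

(** The restricted measure vanishes on subsets of the complement of [D] and agrees with [m] on
    subsets of [D]. *)
Lemma integral_mrestr d (T : measurableType d) (R : realType)
    (m : {measure set T -> \bar R}) (D : set T) (mD : measurable D)
    (f : T -> \bar R) :
  measurable_fun [set: T] f -> (forall x, (0 <= f x)%E) ->
  (\int[mrestr m mD]_x f x = \int[m]_(x in D) f x)%E.
Proof.
move=> mf f_ge0; rewrite -(setvU D) ge0_integral_setU//.
- rewrite (@eq_measure_integral _ _ _ (~` D) mzero (mrestr m mD)); last first.
    move=> A mA AD; have /disjoints_subset AD0 : A `<=` ~` D by [].
    have m0 : m (A `&` D) = 0%E by rewrite AD0 measure0.
    by first [exact: m0|exact: esym m0].
  rewrite integral_measure_zero add0e.
  apply: eq_measure_integral => A mA AD.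
  have mAD : m (A `&` D) = m A by rewrite setIidl.
  by first [exact: mAD|exact: esym mAD].
- exact: measurableC.
- by rewrite setvU.
- by apply/disj_setPS => x [].
Qed.

Definition qs_map (R : realType) (w : measurableTypeR R * (R * R)) : R :=
  w.1 * w.2.1 + (1 - w.1) * w.2.2 + qs_g w.1.

Lemma measurable_qs_map (R : realType) : measurable_fun [set: measurableTypeR R * (R * R)] (@qs_map R).
Proof.
have m1 : measurable_fun [set: measurableTypeR R * (R * R)] (fun w : measurableTypeR R * (R * R) => w.1).
  exact: measurable_fst.
have m2 : measurable_fun [set: measurableTypeR R * (R * R)] (fun w : measurableTypeR R * (R * R) => w.2).
  exact: measurable_snd.
apply: measurable_funD; last by apply: measurableT_comp => //; exact: measurable_qs_g.
apply: measurable_funD; apply: measurable_funM => //.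
- by apply: measurableT_comp => //; exact: measurable_fst.
- by apply: measurable_funB.
- by apply: measurableT_comp => //; exact: measurable_snd.
Qed.

HB.instance Definition _ (R : realType) :=
  isMeasurableFun.Build _ _ _ _ (@qs_map R) (@measurable_qs_map R).

(* Names the probability structure of [P \x P], which unification does not find
   by itself when this product is a factor of another product. *)
Definition self_product d (T : measurableType d) (R : realType)
  (P : probability T R) : probability (T * T)%type R := (P \x P)%E.

Section fixed_point_integrals.
Context {R : realType} (mu : probability R R).
Hypothesis fp : qs_fixed_point mu.
Variable f : R -> \bar R.
Hypothesis mf : measurable_fun [set: R] f.
Hypothesis f_ge0 : forall x, (0 <= f x)%E.

Let M : {measure set (measurableTypeR R * (R * R)) -> \bar R} :=
  (@lebesgue_measure R \x self_product mu)%E.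
Let D : set (measurableTypeR R * (R * R)) := [set w | 0 < w.1 < 1].

Let DE : D = `]0, 1[%classic `*` setT.
Proof. by apply/seteqP; split => -[u v]/=; rewrite /D/= in_itv/=; tauto. Qed.

Let mD : measurable D.
Proof. by rewrite DE; apply: measurableX. Qed.

(** The fixed-point equation says that [mu] is the image under [qs_map] of the product measure
    restricted to [D]; this is the corresponding change of variables. *)
Lemma qs_integral :
  (\int[mu]_x f x = \int[M]_(w in D) f (qs_map w))%E.
Proof.
pose MD : {measure set (measurableTypeR R * (R * R)) -> \bar R} := mrestr M mD.
transitivity (\int[pushforward MD (@qs_map R)]_x f x)%E.
  apply: (@eq_measure_integral _ _ _ setT
    (pushforward MD (@qs_map R) : {measure set _ -> \bar R}) mu) => A mA _.
  apply: (etrans (fp mA)).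
  have -> : [set w : R * (R * R) | 0 < w.1 < 1 /\
      A (w.1 * w.2.1 + (1 - w.1) * w.2.2 + qs_g w.1)] = @qs_map R @^-1` A `&` D.
    by apply/seteqP; split => w /= [].
  by rewrite -[RHS]/(M _).
have mfq : measurable_fun setT (f \o @qs_map R).
  by apply: measurableT_comp => //; exact: measurable_qs_map.
transitivity (\int[MD]_w (f \o @qs_map R) w)%E.
  exact: (ge0_integral_pushforward (@measurable_qs_map R) MD measurableT mf (fun y _ => f_ge0 y)).
exact: (integral_mrestr M mD mfq (fun w => f_ge0 (qs_map w))).
Qed.

(** Extension by zero outside [D], so that Tonelli's theorem can be applied on the whole product
    space. *)
Let F : measurableTypeR R * (R * R) -> \bar R := (fun w => f (qs_map w)) \_ D.

Let mF : measurable_fun setT F.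
Proof.
apply/(measurable_restrictT _ mD)/measurable_funTS; apply: measurableT_comp => //.
Qed.

Let F_ge0 w : (0 <= F w)%E.
Proof. by apply: erestrict_ge0. Qed.

(** Tonelli with [u] outermost: for fixed [u] the independent variables [y] and [z] are integrated
    first, which later produces a product of characteristic functions. *)
Lemma qs_integral_le_uyz (K : R -> R) : measurable_fun [set: R] K ->
  (forall u, 0 < u < 1 -> (\int[mu]_y \int[mu]_z
     f (u * y + (1 - u) * z + qs_g u)%R <= (K u)%:E)%E) ->
  (\int[mu]_x f x <= \int[@lebesgue_measure R]_(u in `]0%R, 1%R[) (K u)%:E)%E.
Proof.
move=> mK fK; rewrite qs_integral integral_mkcond.
rewrite (fubini_tonelli1 F mF F_ge0) [leRHS]integral_mkcond.
have KI : measurable_fun (setT : set (measurableTypeR R)) ((fun u : R => (K u)%:E) \_ `]0%R, 1%R[).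
  apply/(measurable_restrictT _ (measurable_itv _)); apply: measurable_funTS.
  exact: measurableT_comp mK.
have FI u : (0 <= fubini_F (self_product mu) F u)%E by exact: integral_ge0.
have FK u : (fubini_F (self_product mu) F u <=
    ((fun u : R => (K u)%:E) \_ `]0%R, 1%R[) u)%E.
  rewrite /fubini_F patchE; case: ifPn => u01.
    have u01' : 0 < u < 1 by move: u01; rewrite inE/= in_itv.
    apply: le_trans (fK u u01').
    rewrite (fubini_tonelli1 _ (measurableT_comp mF (pair1_measurable u))) => [|yz /=].
      rewrite le_eqVlt; apply/orP; left; apply/eqP; apply: eq_integral => y _; apply: eq_integral => z _.
      by rewrite /= /F patchE mem_set.
    exact: F_ge0.
  under eq_integral.
    move=> yz _; rewrite /F patchE memNset/=; last first.
      by move=> /= u01'; move: u01; rewrite mem_set//= in_itv.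
    over.
  by rewrite integral0.
by apply: ge0_le_integral => //; exact: measurable_fun_fubini_tonelli_F.
Qed.

(** Tonelli with [u] innermost: a bound uniform in [y] and [z] survives integration against a
    probability measure. *)
Lemma qs_integral_le_yzu (c : R) :
  (forall y z, (\int[@lebesgue_measure R]_(u in `]0%R, 1%R[)
     f (u * y + (1 - u) * z + qs_g u)%R <= c%:E)%E) ->
  (\int[mu]_x f x <= c%:E)%E.
Proof.
move=> fc; rewrite qs_integral integral_mkcond (fubini_tonelli2 F mF F_ge0).
have -> : c%:E = (\int[self_product mu]_yz (cst c%:E yz))%E.
  rewrite integral_cst// [X in (_ * X)%E](_ : _ = 1%E) ?mule1//.
  exact: (probability_setT (self_product mu)).
have GI yz : (0 <= fubini_G (@lebesgue_measure R) F yz)%E by exact: integral_ge0.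
apply: ge0_le_integral => //.
- exact: measurable_fun_fubini_tonelli_G.
- move=> -[y z] _; apply: le_trans (fc y z); rewrite [leRHS]integral_mkcond /fubini_G.
  rewrite le_eqVlt; apply/orP; left; apply/eqP; apply: eq_integral => u _; rewrite /F !patchE.
  by rewrite (_ : ((u, (y, z)) \in D) = (u \in `]0%R, 1%R[%classic))// !inE/= in_itv.
Qed.

End fixed_point_integrals.

(** * Characteristic function *)

Lemma sqr_sin_le (R : realType) (x : R) : sin x ^+ 2 <= x ^+ 2.
Proof.
wlog x0 : x / 0 < x => [H|].
  have [/H //|x0|<-] := ltrgtP 0 x; last by rewrite sin0.
  by rewrite -sqrrN -sinN -[leRHS]sqrrN; apply: H; rewrite oppr_gt0.
have [|c _] := @MVT R (@sin R) (@cos R) 0 x x0 (fun z _ => is_derive_sin z).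
  by apply: continuous_subspaceT; exact: continuous_sin.
by rewrite sin0 !subr0 => ->; rewrite exprMn ler_piMl ?sqr_ge0//.
Qed.

Section charfun.
Context {R : realType} (mu : probability R R).

Lemma measurable_trig (h : R -> R) (t : R) : measurable_fun [set: R] h ->
  measurable_fun [set: R] (fun x => cos (t * h x)) /\
  measurable_fun [set: R] (fun x => sin (t * h x)).
Proof.
move=> mh; have mth : measurable_fun [set: R] (fun x => t * h x).
  exact: measurable_funM.
split; apply: measurableT_comp mth; apply: continuous_measurable_fun.
  exact: continuous_cos.
exact: continuous_sin.
Qed.

Lemma integrable_bounded1 (h : R -> R) : measurable_fun [set: R] h ->
  (forall x, `|h x| <= 1) -> mu.-integrable setT (EFin \o h).
Proof.
move=> mh h1; apply: measurable_bounded_integrable => //.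
  by rewrite [ltLHS](_ : _ = 1%E) ?ltry//; exact: probability_setT.
exists 1; split => // M M1 x _; exact: le_trans (h1 x) (ltW M1).
Qed.

Lemma integrable_cosM (t : R) : mu.-integrable setT (EFin \o (fun x => cos (t * x))).
Proof.
apply: integrable_bounded1; first by have [] := @measurable_trig id t.
by move=> x; rewrite ler_norml cos_geN1 cos_le1.
Qed.

Lemma integrable_sinM (t : R) : mu.-integrable setT (EFin \o (fun x => sin (t * x))).
Proof.
apply: integrable_bounded1; first by have [] := @measurable_trig id t.
by move=> x; rewrite ler_norml sin_geN1 sin_le1.
Qed.

(** Linearity, all terms being integrable. It turns extended-valued integrals of nonnegative
    functions into statements about the real numbers [charfun_re] and [charfun_im]. *)
Lemma integral_trig (p q t : R) :
  (\int[mu]_x (1 + (p * cos (t * x) + q * sin (t * x)))%:E =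
   (1 + (p * charfun_re mu t + q * charfun_im mu t))%:E)%E.
Proof.
have ic := integrable_cosM t; have is_ := integrable_sinM t.
have ipc : mu.-integrable setT (EFin \o (fun x => p * cos (t * x))).
  exact: (integrableZl measurableT p ic).
have iqs : mu.-integrable setT (EFin \o (fun x => q * sin (t * x))).
  exact: (integrableZl measurableT q is_).
have ipq : mu.-integrable setT (EFin \o (fun x => p * cos (t * x) + q * sin (t * x))).
  exact: (integrableD measurableT ipc iqs).
have i1 : mu.-integrable setT (EFin \o (cst 1 : R -> R)).
  by apply: integrable_bounded1 => // x; rewrite normr1.
rewrite -[LHS]fineK; last exact: integrable_fin_num (integrableD measurableT i1 ipq).
congr (_%:E); rewrite -/(Rintegral mu setT (fun x => 1 + (p * cos (t * x) + q * sin (t * x)))).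
rewrite (@RintegralD _ _ _ mu setT (cst 1))// RintegralD// !RintegralZl//.
rewrite Rintegral_cst// mul1r [fine _](_ : _ = 1)//.
by rewrite [X in fine X](_ : _ = 1%E)//; exact: (probability_setT mu).
Qed.

Lemma charfun_abs_ge0 (t : R) : 0 <= charfun_abs mu t.
Proof. exact: sqrtr_ge0. Qed.

Lemma sqr_charfun_abs (t : R) :
  charfun_abs mu t ^+ 2 = charfun_re mu t ^+ 2 + charfun_im mu t ^+ 2.
Proof. by rewrite sqr_sqrtr// addr_ge0// sqr_ge0. Qed.

(** The unit vector in the direction of the characteristic function attains its modulus; where the
    function vanishes, any unit vector serves, here [(1, 0)]. *)
Lemma charfun_abs_attained (t : R) : exists p q : R, p ^+ 2 + q ^+ 2 = 1 /\
  p * charfun_re mu t + q * charfun_im mu t = charfun_abs mu t.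
Proof.
have := charfun_abs_ge0 t; rewrite le_eqVlt => /predU1P[z0|a0].
  exists 1, 0; rewrite expr1n expr0n/= addr0; split => //.
  have := sqr_charfun_abs t; rewrite -z0 expr0n/=.
  move/esym/eqP; rewrite paddr_eq0 ?sqr_ge0// !sqrf_eq0 => /andP[/eqP -> /eqP ->].
  by rewrite !mulr0 addr0.
have an0 : charfun_abs mu t != 0 by rewrite gt_eqF.
exists (charfun_re mu t / charfun_abs mu t), (charfun_im mu t / charfun_abs mu t); split.
  by rewrite !expr_div_n -mulrDl -sqr_charfun_abs divff// expf_neq0.
rewrite mulrAC -expr2 [X in _ + X]mulrAC -expr2 -mulrDl -sqr_charfun_abs.
by rewrite expr2 mulfK.
Qed.

Lemma charfun_abs_le (t c : R) :
  (forall p q, p ^+ 2 + q ^+ 2 = 1 ->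
    (\int[mu]_x (1 + (p * cos (t * x) + q * sin (t * x)))%:E <= (1 + c)%:E)%E) ->
  charfun_abs mu t <= c.
Proof.
move=> H; have [p [q [pq1 <-]]] := charfun_abs_attained t.
by have := H _ _ pq1; rewrite integral_trig lee_fin lerD2l.
Qed.

Lemma charfun_abs_le1 (t : R) : charfun_abs mu t <= 1.
Proof.
have [p [q [pq1 <-]]] := charfun_abs_attained t.
(* For the opposite unit vector the integral equals one minus the modulus. *)
have : (0 <= \int[mu]_x (1 + (- p * cos (t * x) + - q * sin (t * x)))%:E)%E.
  apply: integral_ge0 => x _; rewrite lee_fin.
  have := @trig_bound R (- p) (- q) (t * x).
  by rewrite !sqrrN => /(_ pq1)/andP[? ?]; lra.
by rewrite integral_trig lee_fin => ?; lra.
Qed.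

Lemma charfun_absN (t : R) : charfun_abs mu (- t) = charfun_abs mu t.
Proof.
rewrite /charfun_abs.
have -> : charfun_re mu (- t) = charfun_re mu t.
  by apply: eq_Rintegral => x _; rewrite mulNr cosN.
have -> : charfun_im mu (- t) = - charfun_im mu t.
  rewrite /charfun_im -[RHS]mulN1r -RintegralZl//; last exact: integrable_sinM.
  by apply: eq_Rintegral => x _; rewrite mulNr sinN mulN1r.
by rewrite sqrrN.
Qed.

Lemma charfun_abs_norm (t : R) : charfun_abs mu `|t| = charfun_abs mu t.
Proof. by case: ger0P => // _; rewrite charfun_absN. Qed.

(** Integrates [cos x = 1 - 2 sin^2 (x / 2) >= 1 - x^2 / 2]. It shows that the characteristic
    function is nonzero near 0, hence that [cp] is positive. *)
Lemma charfun_re_ge (t : R) :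
  mu.-integrable setT (fun x : R => (x ^+ 2)%:E) ->
  1 - t ^+ 2 / 2 * Rintegral mu setT (fun x => x ^+ 2) <= charfun_re mu t.
Proof.
move=> i2.
have i1 : mu.-integrable setT (EFin \o (cst 1 : R -> R)).
  by apply: integrable_bounded1 => // x; rewrite normr1.
have i2' : mu.-integrable setT (EFin \o (fun x => - (t ^+ 2 / 2) * x ^+ 2)).
  exact: (integrableZl measurableT _ i2).
have <- : Rintegral mu setT (fun x => 1 + - (t ^+ 2 / 2) * x ^+ 2) =
    1 - t ^+ 2 / 2 * Rintegral mu setT (fun x => x ^+ 2).
  rewrite (@RintegralD _ _ _ mu setT (cst 1))// RintegralZl//.
  rewrite Rintegral_cst// mul1r mulNr [fine _](_ : _ = 1)//.
  by rewrite [X in fine X](_ : _ = 1%E)//; exact: (probability_setT mu).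
apply: le_Rintegral => //.
- exact: (integrableD measurableT i1 i2').
- exact: integrable_cosM.
move=> x _; have -> : t * x = (t * x / 2) + (t * x / 2) by field.
rewrite cosD -!expr2.
have := cos2Dsin2 (t * x / 2).
have : sin (t * x / 2) ^+ 2 <= (t * x / 2) ^+ 2.
  exact: sqr_sin_le.
rewrite !expr_div_n exprMn => ? ?; lra.
Qed.

Lemma charfun_abs0 : charfun_abs mu 0 = 1.
Proof.
apply/eqP; rewrite eq_le charfun_abs_le1/=.
have -> : charfun_abs mu 0 = `|charfun_re mu 0|.
  rewrite /charfun_abs [charfun_im mu 0](_ : _ = 0).
    by rewrite expr0n/= addr0 sqrtr_sqr.
  rewrite /charfun_im; under eq_Rintegral do rewrite mul0r sin0.
  by rewrite Rintegral_cst// mul0r.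
apply: le_trans (ler_norm _).
rewrite /charfun_re; under eq_Rintegral do rewrite mul0r cos0.
rewrite Rintegral_cst// mul1r [fine _](_ : _ = 1)//.
by rewrite [X in fine X](_ : _ = 1%E)//; exact: (probability_setT mu).
Qed.

End charfun.

(** * The fixed-point equation for the characteristic function *)

Section charfun_fixed_point.
Context {R : realType} (mu : probability R R).
Hypothesis fp : qs_fixed_point mu.

Let measurable_F (p q t : R) :
  measurable_fun [set: R] (fun x : R => (1 + (p * cos (t * x) + q * sin (t * x)))%:E).
Proof.
have [mc ms] := @measurable_trig R id t (@measurable_id _ _ _).
apply/measurable_EFinP; apply: measurable_funD => //.
by apply: measurable_funD; exact: measurable_funM.
Qed.

Let F_ge0 (p q t : R) : p ^+ 2 + q ^+ 2 = 1 ->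
  forall x : R, (0 <= (1 + (p * cos (t * x) + q * sin (t * x)))%:E)%E.
Proof.
move=> pq1 x; rewrite lee_fin.
by have /andP[? ?] := @trig_bound R p q (t * x) pq1; lra.
Qed.

Lemma charfun_abs_le_rsqrt (t : R) : 0 < t -> charfun_abs mu t <= 2 / Num.sqrt t.
Proof.
move=> t0; apply: charfun_abs_le => p q pq1.
apply: (qs_integral_le_yzu fp (@measurable_F p q t) (@F_ge0 p q t pq1)) => y z.
exact: qs_oscillatory_integral.
Qed.

(** The left side is the real part of [(p - i q) e^(i C) (a + i b) (c + i d)], and the right side is
    the modulus of this product. In the proof the squared modulus is split into the squares of the
    real and imaginary parts. *)
Let rotate_le (p q a b c d C : R) : p ^+ 2 + q ^+ 2 = 1 ->
  (p * c + q * d) * (a * cos C - b * sin C) + (q * c - p * d) * (b * cos C + a * sin C) <=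
  Num.sqrt (a ^+ 2 + b ^+ 2) * Num.sqrt (c ^+ 2 + d ^+ 2).
Proof.
move=> pq1; rewrite -sqrtrM ?addr_ge0 ?sqr_ge0//.
apply: le_trans (ler_norm _) _; rewrite -sqrtr_sqr ler_wsqrtr//.
set x := (X in X ^+ 2 <= _).
have -> : (a ^+ 2 + b ^+ 2) * (c ^+ 2 + d ^+ 2) = x ^+ 2 +
    ((p * c + q * d) * (b * cos C + a * sin C) -
     (q * c - p * d) * (a * cos C - b * sin C)) ^+ 2.
  transitivity ((a ^+ 2 + b ^+ 2) * (cos C ^+ 2 + sin C ^+ 2) *
      ((c ^+ 2 + d ^+ 2) * (p ^+ 2 + q ^+ 2))).
    by rewrite cos2Dsin2 pq1 !mulr1.
  by rewrite /x; ring.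
by rewrite lerDl sqr_ge0.
Qed.

(** Given [u], the two terms [u Y] and [(1 - u) Z] are independent, so the conditional
    characteristic function is the product of those at [u t] and [(1 - u) t], times the phase
    [e^(i t g(u))] of modulus 1. The measurable majorant [K] stands in for the product of moduli. *)
Lemma charfun_abs_le_integral (t c : R) (K : R -> R) :
  measurable_fun [set: R] K -> (forall u, 0 <= K u) ->
  (forall u, 0 < u < 1 -> charfun_abs mu (u * t) * charfun_abs mu ((1 - u) * t) <= K u) ->
  (\int[@lebesgue_measure R]_(u in `]0%R, 1%R[) (K u)%:E <= c%:E)%E ->
  charfun_abs mu t <= c.
Proof.
move=> mK K0 HK Kc; apply: charfun_abs_le => p q pq1.
have mK1 : measurable_fun [set: R] (fun u => 1 + K u) by exact: measurable_funD.
apply: (le_trans (qs_integral_le_uyz fp (@measurable_F p q t) (@F_ge0 p q t pq1) mK1 _)).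
  move=> u u01.
  pose a := charfun_re mu (u * t); pose b := charfun_im mu (u * t).
  pose c' := charfun_re mu ((1 - u) * t); pose d := charfun_im mu ((1 - u) * t).
  pose C := t * qs_g u.
  have inner (y : R) : (\int[mu]_z
      (1 + (p * cos (t * (u * y + (1 - u) * z + qs_g u)) +
            q * sin (t * (u * y + (1 - u) * z + qs_g u))))%:E =
      (1 + (((p * c' + q * d) * cos C + (q * c' - p * d) * sin C) * cos (u * t * y) +
            ((q * c' - p * d) * cos C - (p * c' + q * d) * sin C) * sin (u * t * y)))%:E)%E.
    (* [A] collects the part of the phase free of [z]; the addition formulas then bring the
       integrand to the shape of [integral_trig], first in [z] and afterwards in [y]. *)
    pose A := u * t * y + C.
    transitivity (\int[mu]_z
       (1 + ((p * cos A + q * sin A) * cos ((1 - u) * t * z) +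
             (q * cos A - p * sin A) * sin ((1 - u) * t * z)))%:E)%E.
      apply: eq_integral => z _; congr (_%:E).
      have -> : t * (u * y + (1 - u) * z + qs_g u) = A + (1 - u) * t * z.
        by rewrite /A /C; ring.
      by rewrite (cosD A) (sinD A); ring.
    by rewrite integral_trig -/c' -/d /A cosD sinD; congr (_%:E); ring.
  under eq_integral do rewrite inner.
  rewrite integral_trig lee_fin lerD2l -/a -/b.
  apply: le_trans (HK _ u01); apply: le_trans (@rotate_le p q a b c' d C pq1).
  by rewrite le_eqVlt; apply/orP; left; apply/eqP; ring.
rewrite [leLHS](_ : _ = \int[@lebesgue_measure R]_(u in `]0%R, 1%R[) (1%:E + (K u)%:E))%E//.
rewrite ge0_integralD//; last 2 first.
- by move=> u _; rewrite lee_fin.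
- by apply/measurable_EFinP; exact: measurable_funTS.
rewrite integral_cst//= lebesgue_measure_itv/= lte01 oppr0 adde0 mule1 EFinD.
exact: leeD.
Qed.

End charfun_fixed_point.

(** * Explicit integrals on the unit interval *)

(** The reflection [u -> 1 - u] preserves Lebesgue measure, by uniqueness from the values on
    half-open intervals; the preimage swaps the open and the closed end but keeps the length. *)
Lemma ge0_integral_onem (R : realType) (f : R -> \bar R) :
  measurable_fun [set: R] f -> (forall u, (0 <= f u)%E) ->
  (\int[@lebesgue_measure R]_(u in `]0%R, 1%R[) f (1 - u)%R =
   \int[@lebesgue_measure R]_(u in `]0%R, 1%R[) f u)%E.
Proof.
move=> mf f0.
pose phi := (fun u : measurableTypeR R => (1 - u)%R : measurableTypeR R).
have mphi : measurable_fun setT phi by exact: measurable_onem.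
have pre : phi @^-1` `]0%R, 1%R[%classic = `]0%R, 1%R[%classic.
  apply/seteqP; split => u; rewrite /phi/= !in_itv/= => /andP[? ?].
    by apply/andP; split; lra.
  by apply/andP; split; lra.
have leb_phi A : measurable A -> @lebesgue_measure R A = pushforward (@lebesgue_measure R) phi A.
  move=> mA; pose phiM : {mfun measurableTypeR R >-> measurableTypeR R} :=
    HB.pack phi (isMeasurableFun.Build _ _ _ _ _ mphi).
  apply: (@lebesgue_measure_unique R
    (pushforward (@lebesgue_measure R) phiM)) => //= _ [[a b]] _ <-.
  rewrite [RHS]/pushforward/= [X in _ = lebesgue_measure X](_ : _ = `[1 - b, 1 - a[%classic).
    rewrite !lebesgue_measure_itv/= !lte_fin ltrD2l ltrN2.
    by case: ifP => // _; rewrite -!EFinB; congr (_%:E); ring.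
  apply/seteqP; split => u; rewrite /phi/= !in_itv/= => /andP[? ?].
    by apply/andP; split; lra.
  by apply/andP; split; lra.
have mf' : measurable_fun (`]0%R, 1%R[%classic : set (measurableTypeR R)) f.
  exact: measurable_funTS.
have := ge0_integral_pushforward mphi (@lebesgue_measure R) (measurable_itv _) mf' (fun u _ => f0 u).
rewrite pre => <-.
by apply: eq_measure_integral => A mA _; exact/esym/leb_phi.
Qed.

Lemma ge0_le_integral_cst (R : realType) (f : R -> R) (a b c : R) : a <= b ->
  measurable_fun [set: R] f -> (forall u, 0 <= f u <= c) ->
  (\int[@lebesgue_measure R]_(u in `[a, b]) (f u)%:E <= (c * (b - a))%:E)%E.
Proof.
move=> ab mf fc.
apply: (@le_trans _ _ (\int[@lebesgue_measure R]_(u in `[a, b]) (cst c%:E u))%E).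
  apply: ge0_le_integral => //.
  - by move=> x _; rewrite lee_fin; have /andP[] := fc x.
  - by apply/measurable_EFinP; exact: measurable_funTS.
  - by move=> x _; rewrite lee_fin; have /andP[] := fc x.
rewrite integral_cst//= lebesgue_measure_itv/= lte_fin.
have [ltab|leba] := ltP a b; first by rewrite -EFinB -EFinM.
by rewrite mule0 (_ : b - a = 0) ?mulr0//; lra.
Qed.

Lemma integral_scale_le (R : realType) (f : R -> R) (k c : R) (D : set R) :
  measurable D -> 0 <= k -> measurable_fun [set: R] f -> (forall u, 0 <= f u) ->
  (\int[@lebesgue_measure R]_(u in D) (f u)%:E <= c%:E)%E ->
  (\int[@lebesgue_measure R]_(u in D) (k * f u)%:E <= (k * c)%:E)%E.
Proof.
move=> mD k0 mf f0 fc.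
have -> : (\int[@lebesgue_measure R]_(u in D) (k * f u)%:E =
    k%:E * \int[@lebesgue_measure R]_(u in D) (f u)%:E)%E.
  under eq_integral do rewrite EFinM.
  rewrite ge0_integralZl_EFin//.
    by move=> u _; rewrite lee_fin.
  by apply/measurable_EFinP; exact: measurable_funTS.
by rewrite EFinM lee_wpmul2l// lee_fin.
Qed.

(** The antiderivative [u^q / q] is increasing for either sign of [q]: when [q < 0] the power
    decreases and the factor is negative. Below, [q = 1/2] on the unit interval and [q = 1 - p < 0]
    away from 0 are used. *)
Lemma integral_powR_le (R : realType) (q a b : R) : q != 0 -> 0 <= a -> a < b ->
  0 < q \/ 0 < a ->
  (\int[@lebesgue_measure R]_(u in `]a, b[) (u `^ (q - 1))%:E <=
    (b `^ q / q - a `^ q / q)%:E)%E.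
Proof.
move=> q0 a0 ab qa; have b0 : 0 < b by apply: le_lt_trans ab.
have dG (x : R) : 0 < x -> is_derive x 1 (fun u : R => q^-1 * u `^ q) (x `^ (q - 1)).
  move=> x0; have := is_deriveZ q^-1 (is_derive1_powR q x0).
  by move/is_derive_eq; apply; rewrite /GRing.scale/= mulKf.
apply: (@ge0_integral_oo_le_antiderivative R _ (fun u => u `^ (q - 1))
   (fun u => q^-1 * u `^ q)) => //.
- by move=> x /andP[ax _]; apply: dG; exact: le_lt_trans ax.
- move=> x /andP[ax _]; have x0 := le_lt_trans a0 ax.
  exact: is_derive1_continuous (is_derive1_powR (q - 1) x0).
- by move=> x _; rewrite powR_ge0 lexx.
- move=> x /andP[ax xb]; have x0 := le_lt_trans a0 ax.
  rewrite ![_ / q]mulrC.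
  move: (q0); rewrite neq_lt => /orP[qn|qp].
    have {}a0 : 0 < a by case: qa => // ?; lra.
    rewrite !ler_nM2l ?invr_lt0//.
    have dec (y z : R) : 0 < y -> y <= z -> z `^ q <= y `^ q.
      move=> y0 yz; have z0 := lt_le_trans y0 yz.
      rewrite -[q]opprK powRN [leRHS]powRN lef_pV2 ?posrE ?powR_gt0//.
      by apply: ge0_ler_powR; rewrite ?nnegrE ?oppr_ge0// ltW.
    by rewrite !dec// ltW.
  rewrite !ler_pM2l ?invr_gt0//.
  have inc (y z : R) : 0 <= y -> y <= z -> y `^ q <= z `^ q.
    move=> y0 yz; apply: ge0_ler_powR => //; rewrite ?nnegrE//; last exact: le_trans yz.
    exact: ltW.
  by rewrite !inc// ltW.
- by apply: measurable_funTS; exact: measurable_powR.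
Qed.

(** Splitting at [s], where the two terms of the minimum cross: the part below contributes at most
    [s], the part above at most [s / (p - 1)]. *)
Lemma integral_min_powR_le (R : realType) (p s : R) : 1 < p -> 0 < s ->
  (\int[@lebesgue_measure R]_(u in `]0%R, 1%R[)
    (Num.min 1 ((u / s) `^ (- p)))%:E <= (s * (p / (p - 1)))%:E)%E.
Proof.
move=> p1 s0; pose m (u : R) := Num.min 1 ((u / s) `^ (- p)).
have mm : measurable_fun [set: R] m.
  apply: measurable_minr => //.
  apply: (@measurableT_comp _ _ _ _ _ _ (fun y : R => y `^ (- p)) _ (fun u : R => u / s)).
    exact: measurable_powR.
  exact: measurable_funM.
have m01 u : 0 <= m u <= 1 by rewrite /m le_min ler01 powR_ge0/= ge_min lexx.
have p10 : 0 < p - 1 by lra.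
have sp : s * (p / (p - 1)) = s + s / (p - 1) by field; rewrite gt_eqF.
have sp0 : 0 < s / (p - 1) by rewrite divr_gt0.
have mmE D : measurable_fun D (EFin \o m).
  by apply/measurable_EFinP; exact: measurable_funTS.
have mE0 D x : D x -> (0 <= (m x)%:E)%E by rewrite lee_fin; have /andP[] := m01 x.
(* For [s >= 1] the trivial bound 1 on the whole interval is enough. *)
have [s1|s1] := leP 1 s.
  apply: (@le_trans _ _ (\int[@lebesgue_measure R]_(u in `[0%R, 1%R]) (m u)%:E)%E).
    by apply: ge0_subset_integral => //; [exact: mmE|exact: mE0|exact: subset_itv_oo_cc].
  apply: le_trans (ge0_le_integral_cst ler01 mm m01) _.
  by rewrite lee_fin sp; lra.
apply: (@le_trans _ _
    (\int[@lebesgue_measure R]_(u in `[0%R, s] `|` `]s, 1%R[) (m u)%:E)%E).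
  apply: ge0_subset_integral => //; [exact: measurableU|exact: mmE|exact: mE0|].
  move=> x /=; rewrite !in_itv/= => /andP[x0 x1].
  by have [?|?] := leP x s; [left; rewrite ltW|right].
rewrite ge0_integral_setU//; [|exact: mmE|exact: mE0|]; last first.
  by apply/disj_setPS => x /=; rewrite !in_itv/= => -[/andP[? ?] /andP[? ?]]; lra.
rewrite sp EFinD; apply: leeD.
  by have := ge0_le_integral_cst (ltW s0) mm m01; rewrite subr0 mul1r.
have sE : s / (p - 1) = s `^ p * (s `^ (1 - p) / (p - 1)).
  rewrite mulrA -powRD; last by rewrite [s == 0]gt_eqF// implybT.
  by rewrite (_ : p + (1 - p) = 1) ?powRr1 ?(ltW s0)//; ring.
apply: (@le_trans _ _
    (\int[@lebesgue_measure R]_(u in `]s, 1%R[) (s `^ p * u `^ (1 - p - 1))%:E)%E).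
  apply: ge0_le_integral => //.
  - exact: mE0.
  - exact: mmE.
  - apply/measurable_EFinP; apply: measurable_funTS.
    by apply: measurable_funM; [exact: measurable_cst|exact: (@measurable_powR R (1 - p - 1))].
  - move=> u; rewrite /= in_itv/= => /andP[su _]; rewrite lee_fin /m ge_min.
    apply/orP; right; have u0 := lt_trans s0 su.
    rewrite powRM ?invr_ge0 ?(ltW u0) ?(ltW s0)//.
    rewrite -powR_inv1 ?(ltW s0)// -powRrM mulrNN mul1r mulrC.
    by rewrite [1 - p - 1](_ : _ = - p)//; ring.
rewrite sE.
apply: (@integral_scale_le R (fun u => u `^ (1 - p - 1)) _ _ _ (measurable_itv _)
  (powR_ge0 _ _) (@measurable_powR R _) (fun u => powR_ge0 _ _)).
have q0 : 1 - p != 0 by rewrite lt_eqF//; lra.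
apply: le_trans (integral_powR_le q0 (ltW s0) s1 _) _; first by right.
rewrite lee_fin powR1 [1 - p](_ : _ = - (p - 1)); last by ring.
rewrite invrN !mulrN mul1r opprK.
have : 0 < (p - 1)^-1 by rewrite invr_gt0.
lra.
Qed.

(** The antiderivative [acos (1 - 2 u)] takes its values between 0 and [pi]. *)
Lemma integral_arcsine_le (R : realType) :
  (\int[@lebesgue_measure R]_(u in `]0%R, 1%R[)
     ((u * (1 - u)) `^ (- 2^-1))%:E <= (pi : R)%:E)%E.
Proof.
have E (x : R) : 0 < x < 1 -> -1 < 1 - 2 * x < 1 /\
    2 * (Num.sqrt (1 - (1 - 2 * x) ^+ 2))^-1 = (x * (1 - x)) `^ (- 2^-1).
  move=> /andP[x0 x1]; split; first by apply/andP; split; lra.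
  have y0 : 0 <= x * (1 - x) by rewrite mulr_ge0//; lra.
  rewrite powRN powR12_sqrt//.
  have -> : 1 - (1 - 2 * x) ^+ 2 = 2 ^+ 2 * (x * (1 - x)) by ring.
  by rewrite sqrtrM ?sqr_ge0// sqrtr_sqr ger0_norm// invfM mulVKf.
have -> : pi = pi - 0 :> R by rewrite subr0.
have dphi (x : R) : is_derive x 1 (fun u : R => 1 - 2 * u) (- 2).
  have := is_deriveB (is_derive_cst (1 : R) x 1) (is_deriveZ 2 (is_derive_id x (1 : R))).
  by move/is_derive_eq; apply; rewrite sub0r /GRing.scale/= mulr1.
apply: (@ge0_integral_oo_le_antiderivative R _ (fun u => (u * (1 - u)) `^ (- 2^-1))
  (fun u => acos (1 - 2 * u))) => //.
- move=> x x01; have [x11 <-] := E x x01.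
  have := @is_derive1_comp R (@acos R) _ x _ _ (is_derive1_acos x11) (dphi x).
  by move/is_derive_eq; apply; rewrite mulrNN mulrC.
- move=> x /andP[x0 x1].
  have y0 : 0 < x * (1 - x) by rewrite mulr_gt0//; lra.
  have dy := is_deriveM (is_derive_id x (1 : R)) (is_derive1_onem x).
  exact: (is_derive1_continuous (@is_derive1_comp R (fun y => y `^ (- 2^-1)) _ x _ _
    (is_derive1_powR (- 2^-1) y0) dy)).
- by move=> x _; rewrite powR_ge0 lexx.
- move=> x x01; have [/andP[? ?] _] := E x x01.
  by rewrite acos_ge0 ?acos_lepi//; apply/andP; split; lra.
- apply: measurable_funTS.
  apply: (@measurableT_comp _ _ _ _ _ _ (fun y : R => y `^ (- 2^-1)) _ (fun u : R => u * (1 - u))).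
    exact: measurable_powR.
  by apply: measurable_funM => //; exact: measurable_onem.
Qed.

(** * Decay bounds *)

(** Restricted to positive [t]: the modulus is even in [t], and at 0 the weight [0 ^ p] vanishes for
    [p > 0]. *)
Definition decay_bound (R : realType) (mu : probability R R) (p c : R) : Prop :=
  forall t, 0 < t -> t `^ p * charfun_abs mu t <= c.

Section decay.
Context {R : realType} (mu : probability R R).
Hypothesis fp : qs_fixed_point mu.

Lemma decay_boundP (p c t : R) : decay_bound mu p c -> 0 < t ->
  charfun_abs mu t <= c * t `^ (- p).
Proof.
move=> H t0; have tp := powR_gt0 p t0.
by rewrite powRN ler_pdivlMr// mulrC H.
Qed.

Lemma decay_bound_ge0 (p c : R) : decay_bound mu p c -> 0 <= c.
Proof.
move=> /(_ 1 ltr01); apply: le_trans.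
by rewrite mulr_ge0 ?powR_ge0 ?charfun_abs_ge0.
Qed.

(** The modulus is at most 1, hence at most its own power with exponent [p1 / p2 <= 1]. *)
Lemma decay_bound_mono (p1 p2 c : R) : 0 < p1 -> p1 <= p2 ->
  decay_bound mu p2 c -> decay_bound mu p1 (c `^ (p1 / p2)).
Proof.
move=> p10 p12 H t t0.
have p20 := lt_le_trans p10 p12.
have r0 : 0 <= p1 / p2 by rewrite divr_ge0 ?ltW.
have r1 : p1 / p2 <= 1 by rewrite ler_pdivrMr// mul1r.
have a0 := charfun_abs_ge0 mu t; have a1 := charfun_abs_le1 mu t.
apply: (@le_trans _ _ ((t `^ p2 * charfun_abs mu t) `^ (p1 / p2))); last first.
  apply: ge0_ler_powR => //; last exact: H.
  - by rewrite nnegrE mulr_ge0// powR_ge0.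
  - by rewrite nnegrE (decay_bound_ge0 H).
rewrite powRM ?powR_ge0// -powRrM mulrCA divff ?gt_eqF// mulr1.
rewrite ler_pM2l ?powR_gt0//.
move: a0; rewrite le_eqVlt => /predU1P[<-|a0]; first exact: powR_ge0.
by apply: ger1_powR => //; rewrite a0.
Qed.

Lemma decay_bound_half : decay_bound mu 2^-1 2.
Proof.
move=> t t0; have s0 : 0 < Num.sqrt t by rewrite sqrtr_gt0.
rewrite (powR12_sqrt (ltW t0)) mulrC -ler_pdivlMr//.
exact: charfun_abs_le_rsqrt.
Qed.

Lemma decay_bound_one : decay_bound mu 1 (4 * pi).
Proof.
move=> t t0; rewrite (powRr1 (ltW t0)) mulrC -ler_pdivlMr// mulrAC.
pose k (u : R) := (u * (1 - u)) `^ (- 2^-1).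
have mk : measurable_fun [set: R] k.
  apply: (@measurableT_comp _ _ _ _ _ _ (fun y : R => y `^ (- 2^-1)) _ (fun u : R => u * (1 - u))).
    exact: measurable_powR.
  by apply: measurable_funM => //; exact: measurable_onem.
have k0 u : 0 <= k u by exact: powR_ge0.
have c0 : 0 <= 4 / t by rewrite divr_ge0// ltW.
apply: (@charfun_abs_le_integral R mu fp t _ (fun u => 4 / t * k u)).
- exact: measurable_funM.
- by move=> u; rewrite mulr_ge0.
- move=> u /andP[u0 u1]; have v0 : 0 < 1 - u by rewrite subr_gt0.
  have b1 := decay_boundP decay_bound_half (mulr_gt0 u0 t0).
  have b2 := decay_boundP decay_bound_half (mulr_gt0 v0 t0).
  apply: le_trans (ler_pM (charfun_abs_ge0 _ _) (charfun_abs_ge0 _ _) b1 b2) _.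
  rewrite le_eqVlt; apply/orP; left; apply/eqP.
  rewrite /k !powRM ?(ltW u0) ?(ltW v0) ?(ltW t0)//.
  have -> : t^-1 = t `^ (- 2^-1) * t `^ (- 2^-1).
    rewrite -powRD; last by rewrite [t == 0]gt_eqF// implybT.
    by rewrite -(powR_inv1 (ltW t0)); congr (powR _ _); field.
  ring.
- exact: (integral_scale_le (measurable_itv _) c0 mk k0 (@integral_arcsine_le R)).
Qed.

(** Geometric mean of the bounds of orders 1/2 and 1, with constants 2 and [4 pi]. *)
Lemma decay_bound_three_quarters : decay_bound mu (3 / 4) (Num.sqrt (8 * pi)).
Proof.
move=> t t0; have b1 := decay_bound_half t0; have b2 := decay_bound_one t0.
have a0 := charfun_abs_ge0 mu t.
rewrite -[leLHS]ger0_norm; last by rewrite mulr_ge0// powR_ge0.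
rewrite -sqrtr_sqr ler_wsqrtr// exprMn.
have -> : (t `^ (3 / 4)) ^+ 2 = t `^ 2^-1 * t `^ 1.
  rewrite -powRD; last by rewrite [t == 0]gt_eqF// implybT.
  rewrite expr2 -powRD; last by rewrite [t == 0]gt_eqF// implybT.
  by congr (powR _ _); field.
have -> : t `^ 2^-1 * t `^ 1 * charfun_abs mu t ^+ 2 =
  (t `^ 2^-1 * charfun_abs mu t) * (t `^ 1 * charfun_abs mu t) by ring.
have -> : 8 * pi = 2 * (4 * pi) :> R by ring.
by apply: ler_pM => //; rewrite mulr_ge0// powR_ge0.
Qed.

(** By the symmetry [u -> 1 - u] the product has to be estimated only when its first argument is the
    smaller one; the symmetrized kernel costs the factor 2. *)
Lemma charfun_abs_le_sym_integral (k : R -> R) (t c I : R) :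
  measurable_fun [set: R] k -> (forall u, 0 <= k u) ->
  (\int[@lebesgue_measure R]_(u in `]0%R, 1%R[) (k u)%:E <= I%:E)%E ->
  0 <= c ->
  (forall a b, 0 < a -> 0 < b -> a + b = 1 -> a <= b ->
    charfun_abs mu (a * t) * charfun_abs mu (b * t) <= c * (k a + k b)) ->
  charfun_abs mu t <= c * (2 * I).
Proof.
move=> mk k0 Ik c0 key.
have mk' : measurable_fun [set: R] (fun u => k (1 - u)).
  by apply: (@measurableT_comp _ _ _ _ _ _ k _ (fun u : R => 1 - u)) => //; exact: measurable_onem.
have Ik' : (\int[@lebesgue_measure R]_(u in `]0%R, 1%R[) (k (1 - u))%:E <= I%:E)%E.
  rewrite (@ge0_integral_onem R (fun u => (k u)%:E))//.
  exact/measurable_EFinP.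
have mkk : measurable_fun [set: R] (fun u => k u + k (1 - u)) by exact: measurable_funD.
have kk0 u : 0 <= k u + k (1 - u) by rewrite addr_ge0.
have Ikk : (\int[@lebesgue_measure R]_(u in `]0%R, 1%R[) (k u + k (1 - u))%:E <=
    (2 * I)%:E)%E.
  under eq_integral do rewrite EFinD.
  rewrite ge0_integralD//; last 4 first.
  - by move=> u _; rewrite lee_fin.
  - by apply/measurable_EFinP; exact: measurable_funTS.
  - by move=> u _; rewrite lee_fin.
  - by apply/measurable_EFinP; exact: measurable_funTS.
  by apply: le_trans (leeD Ik Ik') _; rewrite -EFinD lee_fin; lra.
apply: (@charfun_abs_le_integral R mu fp t _ (fun u => c * (k u + k (1 - u)))).
- exact: measurable_funM.
- by move=> u; rewrite mulr_ge0.
- move=> u /andP[u0 u1]; have v0 : 0 < 1 - u by rewrite subr_gt0.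
  have [uv|vu] := leP u (1 - u).
    by apply: key => //; ring.
  by rewrite mulrC [k u + _]addrC; apply: key => //; [ring|exact: ltW].
- exact: (integral_scale_le (measurable_itv _) c0 mkk kk0 Ikk).
Qed.

Lemma decay_bound_three_halves : decay_bound mu (3 / 2) (32 * pi).
Proof.
move=> t t0; have pi0 := @pi_gt0 R.
have tn : (t == 0) = false by rewrite gt_eqF.
pose k (u : R) := u `^ (2^-1 - 1).
have mk : measurable_fun [set: R] k by exact: measurable_powR.
have k0 u : 0 <= k u by exact: powR_ge0.
have Ik : (\int[@lebesgue_measure R]_(u in `]0%R, 1%R[) (k u)%:E <= 2%:E)%E.
  have h0 : 2^-1 != 0 :> R by [].
  apply: le_trans (integral_powR_le h0 (lexx 0) ltr01 _) _; first by left.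
  by rewrite powR0// powR1 lee_fin; lra.
pose c := 8 * pi * t `^ (- (3 / 2)).
have c0 : 0 <= c by rewrite mulr_ge0 ?powR_ge0// mulr_ge0// ltW.
have key (a b : R) : 0 < a -> 0 < b -> a + b = 1 -> a <= b ->
    charfun_abs mu (a * t) * charfun_abs mu (b * t) <= c * (k a + k b).
  move=> a0 b0 ab1 ab.
  have b1 := decay_boundP decay_bound_half (mulr_gt0 a0 t0).
  have b2 := decay_boundP decay_bound_one (mulr_gt0 b0 t0).
  apply: le_trans (ler_pM (charfun_abs_ge0 _ _) (charfun_abs_ge0 _ _) b1 b2) _.
  rewrite !powRM ?(ltW a0) ?(ltW b0) ?(ltW t0)//.

  have -> : 2 * (a `^ (- 2^-1) * t `^ (- 2^-1)) * (4 * pi * (b `^ (-1) * t `^ (-1))) =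
      8 * pi * (t `^ (- 2^-1) * t `^ (-1)) * (a `^ (- 2^-1) * b `^ (-1)) by ring.
  rewrite -powRD ?tn ?implybT// [- 2^-1 + -1](_ : _ = - (3 / 2)); last by field.
  rewrite ler_wpM2l//.
  rewrite /k [2^-1 - 1](_ : _ = - 2^-1); last by field.
  rewrite !powRN !powR12_sqrt ?(ltW a0) ?(ltW b0)// powRr1 ?(ltW b0)//.
  (* The claim is [1 / (r w^2) <= 1 / r + 1 / w]. After clearing denominators it reads
     [r^2 + w^2 <= w^2 + r w], the left side being 1, and follows from [r <= w]. *)
  pose r := Num.sqrt a; pose w := Num.sqrt b.
  have r0 : 0 < r by rewrite sqrtr_gt0.
  have w0 : 0 < w by rewrite sqrtr_gt0.
  have rw : r <= w by exact: ler_wsqrtr.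
  have aE : a = r ^+ 2 by rewrite sqr_sqrtr// ltW.
  have bE : b = w ^+ 2 by rewrite sqr_sqrtr// ltW.
  rewrite -/r -/w bE -invfM.
  have -> : r^-1 + w^-1 = (w ^+ 2 + r * w) / (r * w ^+ 2).
    by field; rewrite !gt_eqF.
  rewrite ler_pdivlMr ?mulr_gt0 ?exprn_gt0// mulVf ?gt_eqF ?mulr_gt0 ?exprn_gt0//.
  rewrite -ab1 aE bE addrC lerD2l expr2 ler_wpM2l// ltW//.
have B := charfun_abs_le_sym_integral mk k0 Ik c0 key.
apply: (@le_trans _ _ (t `^ (3 / 2) * (c * (2 * 2)))).
  by rewrite ler_wpM2l// powR_ge0.
rewrite /c powRN le_eqVlt; apply/orP; left; apply/eqP.
by field; rewrite gt_eqF// powR_gt0.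
Qed.

Lemma decay_bound_succ (p c : R) : 1 < p -> 0 < c -> decay_bound mu p c ->
  decay_bound mu (p + 1) (2 `^ (p + 1) * c `^ (1 + 1 / p) * (p / (p - 1))).
Proof.
move=> p1 c0 H t t0; have p0 : 0 < p by lra.
have tn : (t == 0) = false by rewrite gt_eqF.
(* The value of [u] at which the bound [c (u t)^(-p)] equals 1. *)
pose s := c `^ (1 / p) / t.
have s0 : 0 < s by rewrite divr_gt0 ?powR_gt0.
pose m (u : R) := Num.min 1 ((u / s) `^ (- p)).
have mm : measurable_fun [set: R] m.
  apply: measurable_minr => //.
  apply: (@measurableT_comp _ _ _ _ _ _ (fun y : R => y `^ (- p)) _ (fun u : R => u / s)).
    exact: measurable_powR.
  exact: measurable_funM.
have m0 u : 0 <= m u by rewrite le_min ler01 powR_ge0.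
have Im := integral_min_powR_le p1 s0.
(* Bound for the factor with the larger argument, where [b >= 1/2]. *)
pose d := 2 `^ p * (c * t `^ (- p)).
have d0 : 0 <= d by rewrite !mulr_ge0 ?powR_ge0// ltW.
have key (a b : R) : 0 < a -> 0 < b -> a + b = 1 -> a <= b ->
    charfun_abs mu (a * t) * charfun_abs mu (b * t) <= d * (m a + m b).
  move=> a0 b0 ab1 ab.
  have ma : charfun_abs mu (a * t) <= m a.
    rewrite le_min charfun_abs_le1/=.
    apply: le_trans (decay_boundP H (mulr_gt0 a0 t0)) _.
    rewrite le_eqVlt; apply/orP; left; apply/eqP.
    have -> : a / s = a * t * c `^ (- (1 / p)).
      by rewrite /s powRN; field; rewrite tn/= gt_eqF// powR_gt0.
    rewrite [RHS]powRM ?powR_ge0 ?mulr_ge0 ?(ltW a0) ?(ltW t0)//.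
    rewrite -powRrM mulrNN div1r mulVf ?gt_eqF// powRr1 ?(ltW c0)//.
    by rewrite mulrC.
  have mb : charfun_abs mu (b * t) <= d.
    apply: le_trans (decay_boundP H (mulr_gt0 b0 t0)) _.
    rewrite /d mulrCA ler_pM2l// powRM ?(ltW b0) ?(ltW t0)//.
    rewrite ler_wpM2r ?powR_ge0// -[b]invrK -powR_inv1 ?invr_ge0 ?(ltW b0)//.
    rewrite -powRrM mulrNN mul1r.
    apply: ge0_ler_powR; rewrite ?nnegrE ?invr_ge0 ?(ltW b0) ?(ltW p0)//.
    rewrite -[2]invrK lef_pV2 ?posrE//; lra.
  rewrite mulrC; apply: ler_pM; rewrite ?charfun_abs_ge0//.
  by apply: le_trans ma _; rewrite lerDl.
have B := charfun_abs_le_sym_integral mm m0 Im d0 key.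
apply: (@le_trans _ _ (t `^ (p + 1) * (d * (2 * (s * (p / (p - 1))))))).
  by rewrite ler_wpM2l// powR_ge0.
have -> : t `^ (p + 1) = t `^ p * t.
  by rewrite powRD ?tn ?implybT// powRr1// ltW.
have -> : 2 `^ (p + 1) = 2 `^ p * 2 :> R.
  by rewrite powRD ?pnatr_eq0 ?implybT// powRr1.
have -> : c `^ (1 + 1 / p) = c * c `^ (1 / p).
  by rewrite powRD ?(gt_eqF c0) ?implybT// powRr1// ltW.
rewrite /d /s powRN le_eqVlt; apply/orP; left; apply/eqP.
field; rewrite tn/= [t `^ p == 0]gt_eqF ?powR_gt0//= gt_eqF//; lra.
Qed.

End decay.

(** Convexity of [2^(-x)] on [[0, 1]] gives [2^(-x) <= 1 - x / 2]; at [x = 2 / q] this is the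
    reciprocal inequality. *)
Lemma ratio_le_powR2 (R : realType) (q : R) : 2 <= q -> q / (q - 1) <= 2 `^ (2 / q).
Proof.
move=> q2; have q0 : 0 < q by lra. have q1 : 0 < q - 1 by lra.
have t0 : 0 <= 2 / q by rewrite divr_ge0// ltW.
have t1 : 2 / q <= 1 by rewrite ler_pdivrMr// mul1r.
have := @convex_expR R (Itv01 t0 t1) (- ln 2) 0.
rewrite !convRE/= expR0 expRN lnK ?posrE// mulr0 addr0.
have -> : 2 / q * - ln 2 = - (2 / q * ln 2) by ring.
rewrite expRN /powR pnatr_eq0/= => h.
have e0 := expR_gt0 (2 / q * ln 2).
rewrite -lef_pV2 ?posrE ?divr_gt0// (le_trans h)// le_eqVlt; apply/orP; left; apply/eqP.
by rewrite /unstable.onem; field; rewrite !gt_eqF.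
Qed.

Lemma decay_bound_le (R : realType) (mu : probability R R) (p c1 c2 : R) :
  c1 <= c2 -> decay_bound mu p c1 -> decay_bound mu p c2.
Proof. by move=> c12 H t t0; exact: le_trans (H t t0) c12. Qed.

(** * Explicit decay constants as powers of two *)

Section decay_constants.
Context {R : realType} (mu : probability R R).
Hypothesis fp : qs_fixed_point mu.

Let powR2M (a b : R) : (2 `^ a) `^ b = 2 `^ (a * b) :> R.
Proof. by rewrite powRrM. Qed.

Let powR2D (a b : R) : 2 `^ a * 2 `^ b = 2 `^ (a + b) :> R.
Proof. by rewrite powRD// pnatr_eq0 implybT. Qed.

Let powR2_le (a b : R) : a <= b -> 2 `^ a <= 2 `^ b :> R.
Proof. by move=> ab; apply: ler_powR; rewrite ?ler1n. Qed.

Lemma decay_bound_five_halves : decay_bound mu (5 / 2) (2 `^ 16).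
Proof.
have pi4 : 32 * pi <= 2 `^ 7 :> R.
  have := @pihalf_lt2 R; rewrite powR_mulrn// => ?; lra.
have H := decay_bound_le pi4 (decay_bound_three_halves fp).
have p1 : 1 < 3 / 2 :> R by lra.
have := decay_bound_succ fp p1 (powR_gt0 7 (ltr0n R 2)) H.
have -> : 3 / 2 + 1 = 5 / 2 :> R by field.
apply: decay_bound_le.
(* [3^6 = 729 <= 2048 = 2^11]. The exponent 11/6 is what remains of 16 after [5/2 + 7 * (5/3)]. *)
have three : 3 <= 2 `^ (11 / 6) :> R.
  have -> : 3 = (3 ^+ 6) `^ (6^-1) :> R.
    by rewrite -powR_mulrn// -powRrM divff// powRr1.
  have -> : 2 `^ (11 / 6) = (2 ^+ 11) `^ (6^-1) :> R.
    by rewrite -powR_mulrn// -powRrM.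
  by apply: ge0_ler_powR; rewrite ?nnegrE ?exprn_ge0//; lra.
rewrite powR2M powR2D.
have -> : 3 / 2 / (3 / 2 - 1) = 3 :> R by field.
apply: (@le_trans _ _ (2 `^ (5 / 2 + 7 * (1 + 1 / (3 / 2))) * 2 `^ (11 / 6))).
  by rewrite ler_wpM2l// powR_ge0.
by rewrite powR2D; apply: powR2_le; lra.
Qed.

(** The exponent is [7/2 + 16 * (7/5) + 1], with the factor 5/3 bounded by 2. Rounding it up to 27
    would be too coarse for the interpolation down to [p = 5/2] in [decay_bound_pow_ge]. *)
Lemma decay_bound_seven_halves : decay_bound mu (7 / 2) (2 `^ (269 / 10)).
Proof.
have p1 : 1 < 5 / 2 :> R by lra.
have := decay_bound_succ fp p1 (powR_gt0 16 (ltr0n R 2)) decay_bound_five_halves.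
have -> : 5 / 2 + 1 = 7 / 2 :> R by field.
apply: decay_bound_le; rewrite powR2M powR2D.
apply: (@le_trans _ _ (2 `^ (7 / 2 + 16 * (1 + 1 / (5 / 2))) * 2 `^ 1)).
  have -> : 5 / 2 / (5 / 2 - 1) = 5 / 3 :> R by field.
  by rewrite powRr1//; apply: ler_wpM2l; [exact: powR_ge0|lra].
by rewrite powR2D; apply: powR2_le; lra.
Qed.

(* The exponent is lowered by 2 so that the factor [p / (p - 1)] of the
   recursion is absorbed: it is at most [2 ^ (2 / p)]. *)
Lemma decay_bound_pow_ge (p : R) : 5 / 2 <= p ->
  decay_bound mu p (2 `^ (p ^+ 2 + 6 * p - 2)).
Proof.
move=> p52.
have [n] : exists n : nat, p <= 7 / 2 + n%:R.
  by exists (Num.truncn p).+1; have := truncnS_gt p => ?; lra.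
(* Base case: orders in [[5/2, 7/2]] are interpolated from order 7/2. Each further unit of [p] costs
   one use of the recursion. *)
elim: n p p52 => [|n IH] p p52 pn.
  have p0 : 0 < p by lra.
  have p72 : p <= 7 / 2 by move: pn; rewrite addr0.
  apply: decay_bound_le (decay_bound_mono p0 p72 decay_bound_seven_halves).
  rewrite powR2M; apply: powR2_le.
  have : 5 / 2 * p <= p ^+ 2 by rewrite expr2 ler_wpM2r// ltW.
  lra.
have [p72|p72] := leP p (7 / 2 + n%:R); first exact: IH.
have q52 : 5 / 2 <= p - 1 by have : (0 : R) <= n%:R by []; lra.
have qn : p - 1 <= 7 / 2 + n%:R by move: pn; rewrite -natr1; lra.
have q1 : 1 < p - 1 by lra.
have := decay_bound_succ fp q1 (powR_gt0 _ (ltr0n R 2)) (IH _ q52 qn).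
rewrite subrK; apply: decay_bound_le.
rewrite powR2M powR2D.
have q2 : 2 <= p - 1 by lra.
apply: le_trans (ler_wpM2l (powR_ge0 _ _) (ratio_le_powR2 q2)) _.
rewrite powR2D; apply: powR2_le.
(* With [q = p - 1] the exponents match exactly: [(q^2 + 6 q - 2) (1 + 1/q)] contributes [-2/q],
   which cancels the [2/q] of the ratio. *)
rewrite le_eqVlt; apply/orP; left; apply/eqP; field.
by rewrite gt_eqF//; lra.
Qed.

Lemma decay_bound_pow (p : R) : 0 < p -> decay_bound mu p (2 `^ (p ^+ 2 + 6 * p)).
Proof.
(* Below 5/2 the bound is interpolated from order 1/2 when [p <= 1/2], and otherwise from [2^16] at
   order 5/2, where [p >= 1/2] gives [(32/5) p <= p^2 + 6 p]. *)
move=> p0; have [p52|/ltW p52] := leP p (5 / 2); last first.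
  by apply: decay_bound_le (decay_bound_pow_ge p52); apply: powR2_le; lra.
have [p12|/ltW p12] := leP p 2^-1.
  apply: decay_bound_le (decay_bound_mono p0 p12 (decay_bound_half fp)).
  rewrite invrK; apply: powR2_le; have := sqr_ge0 p; lra.
apply: decay_bound_le (decay_bound_mono p0 p52 decay_bound_five_halves).
rewrite powR2M; apply: powR2_le.
have : 2^-1 * p <= p ^+ 2 by rewrite expr2 ler_wpM2r// ltW.
lra.
Qed.

(** * From decay bounds to the suprema [cp] *)

Lemma cp_le (p c : R) : 0 < p -> decay_bound mu p c -> (cp mu p <= c%:E)%E.
Proof.
move=> p0 H; apply: ge_ereal_sup => _ [t _ <-]; rewrite lee_fin.
have [->|t0] := eqVneq t 0.
  by rewrite normr0 powR0 ?gt_eqF// mul0r; exact: decay_bound_ge0 H.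
by rewrite -charfun_abs_norm; apply: H; rewrite normr_gt0.
Qed.

Lemma cp_ge (p t : R) : ((`|t| `^ p * charfun_abs mu t)%:E <= cp mu p)%E.
Proof. by apply: ereal_sup_ubound; exists t. Qed.

(** Makes [fine] faithful on [cp]; at an infinite value [fine] would return 0. *)
Lemma cp_fin_num (p : R) : 0 < p -> cp mu p \is a fin_num.
Proof.
move=> p0; rewrite ge0_fin_numE.
  by apply: le_lt_trans (cp_le p0 (decay_bound_pow p0)) _; exact: ltry.
apply: le_trans (cp_ge p 0).
by rewrite lee_fin mulr_ge0 ?powR_ge0 ?charfun_abs_ge0.
Qed.

Lemma decay_bound_cp (p : R) : 0 < p -> decay_bound mu p (fine (cp mu p)).
Proof.
move=> p0 t t0; rewrite -lee_fin fineK ?cp_fin_num//.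
by have := cp_ge p t; rewrite gtr0_norm.
Qed.

Lemma fine_cp_le (p c : R) : 0 < p -> decay_bound mu p c -> fine (cp mu p) <= c.
Proof. by move=> p0 /(cp_le p0); rewrite -lee_fin fineK// cp_fin_num. Qed.

Lemma cp0 : cp mu 0 = 1%E.
Proof.
apply/eqP; rewrite eq_le; apply/andP; split.
  apply: ge_ereal_sup => _ [t _ <-].
  by rewrite powRr0 mul1r lee_fin charfun_abs_le1.
by have := cp_ge 0 0; rewrite powRr0 mul1r charfun_abs0.
Qed.

Lemma cp_gt0 (p : R) : mu.-integrable setT (fun x : R => (x ^+ 2)%:E) ->
  (0 < cp mu p)%E.
Proof.
move=> i2; pose v := Rintegral mu setT (fun x : R => x ^+ 2).
have v0 : 0 <= v.
  by apply: fine_ge0; apply: integral_ge0 => x _; rewrite lee_fin sqr_ge0.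
(* One point with a nonzero characteristic function suffices. Here [t v = 1 - t], so the lower bound
   for the real part is [1 - t (1 - t) / 2], which is positive. *)
pose t := (1 + v)^-1.
have t0 : 0 < t by rewrite invr_gt0; lra.
have tv : t * (1 + v) = 1 by rewrite mulVf// gt_eqF//; lra.
have re0 : 0 < charfun_re mu t.
  apply: lt_le_trans (charfun_re_ge t i2); rewrite -/v.
  have ? : t <= 1 by nra.
  have -> : t ^+ 2 / 2 * v = t * (t * v) / 2 by ring.
  have -> : t * v = 1 - t by lra.
  nra.
apply: lt_le_trans (cp_ge p t); rewrite lte_fin mulr_gt0//.
  by rewrite powR_gt0// normr_gt0 gt_eqF.
by rewrite sqrtr_gt0 ltr_wpDr ?sqr_ge0// exprn_gt0.
Qed.

Lemma fine_cp_root_mono (p1 p2 : R) : 0 < p1 -> p1 <= p2 ->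
  fine (cp mu p1) `^ (1 / p1) <= fine (cp mu p2) `^ (1 / p2).
Proof.
move=> p10 p12; have p20 := lt_le_trans p10 p12.
have -> : fine (cp mu p2) `^ (1 / p2) = (fine (cp mu p2) `^ (p1 / p2)) `^ (1 / p1).
  by rewrite -powRrM; congr (powR _ _); field; rewrite !gt_eqF.
apply: ge0_ler_powR.
- by rewrite divr_ge0// ltW.
- by rewrite nnegrE (decay_bound_ge0 (decay_bound_cp p10)).
- by rewrite nnegrE powR_ge0.
- apply: fine_cp_le => //; apply: decay_bound_mono => //; exact: decay_bound_cp.
Qed.

End decay_constants.

Unset Implicit Arguments.

Theorem theorem2p1 (R : realType) (mu : probability R R) :
  quicksort_law mu ->
  (forall p : R, 0 <= p -> (0 < cp mu p)%E /\ (cp mu p < +oo)%E) /\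
      cp mu 0 = 1%E /\
      fine (cp mu (1 / 2)) <= 2 /\
      fine (cp mu (3 / 4)) <= Num.sqrt (8 * pi) /\
      fine (cp mu 1) <= 4 * pi /\
      fine (cp mu (3 / 2)) < 187 /\
      fine (cp mu (5 / 2)) < 103 * 10 ^+ 3 + 215 /\
      fine (cp mu (7 / 2)) < 197 * 10 ^+ 6 + 102 * 10 ^+ 3 + 280 /\
      (forall p1 p2 : R, 0 < p1 -> p1 <= p2 ->
         fine (cp mu p1) `^ (1 / p1) <= fine (cp mu p2) `^ (1 / p2)) /\
      (forall p : R, 1 < p ->
         fine (cp mu (p + 1)) <=
           2 `^ (p + 1) * fine (cp mu p) `^ (1 + 1 / p) * (p / (p - 1))) /\
    (forall p : R, 0 < p -> fine (cp mu p) <= 2 `^ (p ^+ 2 + 6 * p)).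
Proof.
move=> [i2 _ fp].
split.
  move=> p; rewrite le_eqVlt => /predU1P[<-|p0].
    by rewrite cp0; split; [rewrite lte_fin|exact: ltry].
  split; first exact: cp_gt0.
  by apply: le_lt_trans (cp_le p0 (decay_bound_pow fp p0)) _; exact: ltry.
split; first exact: cp0.
split; first by rewrite div1r; apply: fine_cp_le => //; exact: decay_bound_half.
split; first by apply: fine_cp_le => //; exact: decay_bound_three_quarters.
split; first by apply: fine_cp_le => //; exact: decay_bound_one.
split.
  apply: (@le_lt_trans _ _ (32 * pi)).
    by apply: fine_cp_le => //; exact: decay_bound_three_halves.
  by have := @pihalf_lt2 R => ?; lra.
split.
  apply: (@le_lt_trans _ _ (2 `^ 16)).
    by apply: fine_cp_le => //; exact: decay_bound_five_halves.
  by rewrite powR_mulrn//; lra.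
split.
  (* Rounding up to an integer exponent makes the power computable: [2^27 = 134217728]. *)
  apply: (@le_lt_trans _ _ (2 `^ 27)).
    apply: fine_cp_le => //.
    apply: decay_bound_le (decay_bound_seven_halves fp).
    by apply: ler_powR; rewrite ?ler1n//; lra.
  by rewrite powR_mulrn//; lra.
split; first exact: fine_cp_root_mono.
split.
  move=> p p1; have p0 := lt_trans ltr01 p1.
  apply: fine_cp_le => //; first by rewrite addr_gt0.
  apply: decay_bound_succ => //; last exact: decay_bound_cp.
  (* The recursion divides by a power of its constant, so it is applied to a positive one. *)
  by rewrite -lte_fin fineK ?cp_fin_num//; exact: cp_gt0.
by move=> p p0; apply: fine_cp_le => //; exact: decay_bound_pow.
Qed.
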